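(* Let $n\geq 2$. Every distinguished variety $\Omega$ in the polydisc $\mathbb D^n$ is a part of an affine algebraic curve in $\mathbb C^n$; that is, there is an algebraic set $C\subset\mathbb C^n$ of complex dimension one such that $\Omega=C\cap\mathbb D^n$.
   Context: $\mathbb D$ is the open unit disc and $\mathbb T$ the unit circle in $\mathbb C$. An algebraic set in $\mathbb C^n$ is the common zero set of some subset of $\mathbb C[z_1,\dots,z_n]$; an algebraic variety is an irreducible algebraic set. An affine algebraic curve is an algebraic set of complex dimension one. A distinguished set in $\mathbb D^n$ is a set $\Omega=W\cap\mathbb D^n$, where $W\subset\mathbb C^n$ is an algebraic set of complex dimension greater than zero which intersects $\mathbb D^n$ and exits $\mathbb D^n$ only through the torus $\mathbb T^n$, i.e. $W\cap\partial\mathbb D^n=W\cap\mathbb T^n$, where $\partial\mathbb D^n=\overline{\mathbb D^n}\setminus\mathbb D^n$. A distinguished variety in $\mathbb D^n$ is a distinguished set determined by an irreducible algebraic set $W$. *)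

(* Defs.v *)
From HB Require Import structures.
From mathcomp Require Import all_boot all_order all_algebra.
From mathcomp Require Import complex.
From mathcomp Require Import mpoly.
From mathcomp Require Import boolp classical_sets reals topology normedtype.

Set Implicit Arguments.
Unset Strict Implicit.
Unset Printing Implicit Defensive.

Import Order.TTheory GRing.Theory Num.Theory.
Import numFieldNormedType.Exports.

Local Open Scope classical_set_scope.
Local Open Scope ring_scope.

(* R[i] has no declared topology of its own; packed as a numClosedFieldType it
   receives the one given by its norm, hence a topology on 'rV[CC R]_n too.
   `|z| : CC R is the modulus embedded in CC R, and [`|z| < 1] is the usual
   comparison because moduli are real. *)
Definition CC (R : realType) : numClosedFieldType := R[i].

Section AlgebraicSets.
Context {R : realType} {n : nat}.
Implicit Types W A B : set 'rV[CC R]_n.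

Definition zero_locus (S : set {mpoly (CC R)[n]}) : set 'rV[CC R]_n :=
  [set z | forall p, S p -> p.@[z 0] = 0].

Definition algebraic_set W : Prop :=
  exists S : set {mpoly (CC R)[n]}, W = zero_locus S.

(* The empty set is not irreducible. *)
Definition irreducible_algebraic_set W : Prop :=
  [/\ algebraic_set W,
      W !=set0 &
      forall A B, algebraic_set A -> algebraic_set B ->
        W = A `|` B -> W = A \/ W = B].

(* V 0, ..., V d is a strictly increasing chain of algebraic varieties
   contained in W; the values of V beyond d are irrelevant. *)
Definition variety_chain W (d : nat) (V : nat -> set 'rV[CC R]_n) : Prop :=
  [/\ forall k, (k <= d)%N -> irreducible_algebraic_set (V k),
      forall k, (k < d)%N -> V k `<` V k.+1 &
      V d `<=` W].

(* The complex dimension of an algebraic set is its Krull dimension: the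
   largest d for which such a chain exists. The empty set has no dimension. *)
Definition has_dimension W (d : nat) : Prop :=
  (exists V, variety_chain W d V) /\
  (forall e V, variety_chain W e V -> (e <= d)%N).

End AlgebraicSets.

Section Polydisc.
Variables (R : realType) (n : nat).

Definition polydisc : set 'rV[CC R]_n := [set z | forall i, `|z 0 i| < 1].

Definition torus : set 'rV[CC R]_n := [set z | forall i, `|z 0 i| = 1].

Definition polydisc_boundary : set 'rV[CC R]_n := closure polydisc `\` polydisc.

End Polydisc.

Arguments polydisc R n : clear implicits.
Arguments torus R n : clear implicits.
Arguments polydisc_boundary R n : clear implicits.

Section Distinguished.
Context {R : realType} {n : nat}.
Implicit Types W Omega : set 'rV[CC R]_n.

Definition determines_distinguished_set W Omega : Prop :=
  [/\ algebraic_set W,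
      exists2 d, (0 < d)%N & has_dimension W d,
      W `&` polydisc R n !=set0,
      W `&` polydisc_boundary R n = W `&` torus R n &
      Omega = W `&` polydisc R n].

Definition distinguished_variety Omega : Prop :=
  exists2 W, irreducible_algebraic_set W & determines_distinguished_set W Omega.

End Distinguished.

(* Main.v *)
(* Suppose W has dimension at least 2 and let p be a point of W in the open polydisc.
   Choose a Noether normalization x = (x_0, ..., x_k) : W -> C^(k+1) by linear changes
   of variables so small that x_0 stays close to the coordinate z_0; then the slice x_0
   = x_0(p) of W misses the torus, so its part in the closed polydisc lies in the open
   one. For k >= 1, restrict the finite map x to the line through x(p) on which only x_1
   varies: the part of the slice in the polydisc over this line has compact image, but
   also open image because a finite map onto affine space is open, which is absurd in C.
   If k = 0, the dimension of W is at most 1. Openness holds since a function h on W has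
   a minimal polynomial over C[x] with polynomial coefficients: its roots vary
   continuously, and each root lifts to a point of W, where h can be chosen to separate
   a given point from the rest of its fibre. *)
Require Import Defs.
From HB Require Import structures.
From mathcomp Require Import all_boot all_order all_algebra.
From mathcomp Require Import complex.
From mathcomp Require Import mpoly.
From mathcomp Require Import boolp classical_sets reals topology normedtype.
From mathcomp Require Import generic_quotient ring_quotient ring.

Set Implicit Arguments.
Unset Strict Implicit.
Unset Printing Implicit Defensive.

Import Order.TTheory GRing.Theory Num.Theory.
Import numFieldNormedType.Exports.

Local Open Scope classical_set_scope.
Local Open Scope ring_scope.

(** * Multivariate polynomials *)

Lemma rmorph_mpoly_ext (n : nat) (R S : comNzRingType)
    (phi psi : {rmorphism {mpoly R[n]} -> S}) :
  (forall c, phi c%:MP = psi c%:MP) -> (forall i, phi 'X_i = psi 'X_i) ->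
  phi =1 psi.
Proof.
move=> eqC eqX p; rewrite (mpolyE p) !rmorph_sum; apply: eq_bigr => m _.
rewrite -mul_mpolyC !rmorphM eqC; congr (_ * _).
rewrite mpolyXE_id !rmorph_prod; apply: eq_bigr => i _.
by rewrite !rmorphXn eqX.
Qed.

Lemma mmap_rmorph (n : nat) (R S T : comNzRingType) (f : {rmorphism R -> S})
    (h : 'I_n -> S) (phi : {rmorphism S -> T}) (p : {mpoly R[n]}) :
  phi (mmap f h p) = mmap (phi \o f) (phi \o h) p.
Proof.
rewrite /mmap rmorph_sum; apply: eq_bigr => m _.
by rewrite rmorphM /mmap1 rmorph_prod; congr (_ * _); apply: eq_bigr => i _; rewrite rmorphXn.
Qed.

Lemma widen_ord_lift (n : nat) (i : 'I_n) : widen_ord (leqnSn n) i = lift ord_max i.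
Proof. by apply/val_inj; exact/esym/lift_max. Qed.

(** Makes [muni] injective: every coefficient of [p] is found among those of [muni p]. *)
Lemma coef_muni (n : nat) (R : comNzRingType) (p : {mpoly R[n.+1]}) (m : 'X_{1..n.+1}) :
  (muni p)`_(m ord_max) @_[multinom m (widen_ord (leqnSn n) i) | i < n] = p@_m.
Proof.
have eqm (m' : 'X_{1..n.+1}) :
    ([multinom m' (widen_ord (leqnSn n) i) | i < n]
       == [multinom m (widen_ord (leqnSn n) i) | i < n])
    && (m' ord_max == m ord_max) = (m' == m).
  apply/andP/eqP => [[/eqP e /eqP e']|->]; last by rewrite !eqxx.
  apply/mnmP => i; case: (unliftP ord_max i) => [j|] -> //.
  have := congr1 (fun x : 'X_{1..n} => x j) e; rewrite !mnmE.
  by rewrite widen_ord_lift.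
rewrite muniE coef_sum raddf_sum /=.
have H m' : ((p@_m' *: 'X_[[multinom m' (widen_ord (leqnSn n) i) | i < n]] *:
      'X^(m' ord_max) : {poly {mpoly R[n]}})`_(m ord_max))@_
     [multinom m (widen_ord (leqnSn n) i) | i < n] = if m' == m then p@_m' else 0.
  rewrite coefZ coefXn -eqm andbC eq_sym; case: eqP => _ /=; last by rewrite mulr0 mcoeff0.
  by rewrite mulr1 mcoeffZ mcoeffX; case: eqP; rewrite ?mulr1 ?mulr0.
under eq_bigr do rewrite H.
rewrite -big_mkcond /=.
have [mp|mp] := boolP (m \in msupp p).
  by rewrite (big_rem m) //= eqxx big_seq_cond big1 ?addr0 // => i /andP [+ /eqP ei];
     rewrite ei mem_rem_uniqF // msupp_uniq.
rewrite (memN_msupp_eq0 mp) big_seq_cond big1 // => i /andP [+ /eqP ei].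
by rewrite ei (negbTE mp).
Qed.

Lemma muni_eval (n : nat) (R : comNzRingType) (p : {mpoly R[n.+1]}) (v : 'I_n.+1 -> R) :
  p.@[v] = (map_poly (meval (v \o widen_ord (leqnSn n))) (muni p)).[v ord_max].
Proof.
rewrite mevalE muniE rmorph_sum horner_sum; apply: eq_bigr => m _ /=.
rewrite map_polyZ hornerZ map_polyXn hornerXn. rewrite /= mevalZ mevalX -mulrA; congr (_ * _).
rewrite big_ord_recr /=; congr (_ * _); apply: eq_bigr => i _.
by rewrite mnmE.
Qed.

Lemma exists_nonroot (F : numFieldType) (p : {poly F}) (e : F) : p != 0 -> 0 < e ->
  exists2 t, 0 < t < e & p.[t] != 0.
Proof.
move=> p0 e0.
(* These are [size p] distinct points e/2, e/3, ... of the interval, one more than [p] can have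
   roots. *)
pose s := [seq e / i.+2%:R | i <- iota 0 (size p)].
have us : uniq s.
  rewrite map_inj_uniq ?iota_uniq // => i j /(mulfI (lt0r_neq0 e0)) /invr_inj /eqP.
  by rewrite eqr_nat => /eqP [].
have : ~~ all (root p) s.
  by apply/negP => al; have := max_poly_roots p0 al us; rewrite size_map size_iota ltnn.
rewrite -has_predC => /hasP [t /mapP [i _ ->] /= nr].
exists (e / i.+2%:R) => //; rewrite divr_gt0 ?ltr0n //=.
by rewrite ltr_pdivrMr ?ltr0n // ltr_pMr // ltr1n.
Qed.

Lemma mpoly_exists_nonroot (F : numFieldType) (n : nat) (p : {mpoly F[n]}) :
  p != 0 -> exists v, p.@[v] != 0.
Proof.
elim: n p => [|n IH] p p0.
  exists (fun=> 0); apply: contraNneq p0; rewrite mevalE => e.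
  have h (m : 'X_{1..0}) : m = 0%MM by apply/mnmP => -[].
  apply/eqP/mpolyP => m; rewrite (h m) mcoeff0 -e.
  have [mp|mp] := boolP (0%MM \in msupp p); last first.
    by rewrite big_seq_cond big1 ?memN_msupp_eq0 // => i /andP [+ _]; rewrite (h i) (negbTE mp).
  rewrite (big_rem 0%MM) //= big_ord0 mulr1 big_seq_cond big1 ?addr0 // => i /andP [+ _].
  by rewrite (h i) mem_rem_uniqF // msupp_uniq.
have mp0 : muni p != 0.
  apply: contraNneq p0 => e; apply/eqP/mpolyP => m.
  by rewrite -coef_muni e coef0 !mcoeff0.
(* The first [n] coordinates avoid the zeros of the leading coefficient in the last variable; the
   last coordinate then only has to avoid finitely many roots. *)
have /IH [v vP] : lead_coef (muni p) != 0 by rewrite lead_coef_eq0.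
have q0 : map_poly (meval v) (muni p) != 0.
  apply: contraNneq vP => e; rewrite lead_coefE -coef_map /=.
  by rewrite e coef0.
have [t _ tP] := exists_nonroot q0 ltr01.
exists (fun i => if unlift ord_max i is Some j then v j else t).
rewrite muni_eval unlift_none.
rewrite (_ : map_poly _ _ = map_poly (meval v) (muni p)) //.
apply: eq_map_poly => q; apply: meval_eq => i /=.
by rewrite widen_ord_lift liftK.
Qed.

Lemma mpoly_ext (F : numFieldType) (n : nat) (p q : {mpoly F[n]}) :
  (forall v, p.@[v] = q.@[v]) -> p = q.
Proof.
move=> e; apply/eqP; rewrite -subr_eq0; apply: contraT => /mpoly_exists_nonroot [v].
by rewrite mevalB e subrr eqxx.
Qed.

(** [line_subst o y] restricts a polynomial to the line through [o] with direction [y], the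
    parameter being ['X]. [subst x] composes with the tuple [x]; followed by [theta] it is the map
    F[x] -> K of a Noether normalization. *)
Local Notation line_subst o y := (mmap polyC (fun i => (o i)%:P + y i *: 'X)).
Local Notation subst x := (mmap (@mpolyC _ _) x).

Lemma horner_line_subst (F : fieldType) (n : nat) (o y : 'I_n -> F) (p : {mpoly F[n]}) t :
  (line_subst o y p).[t] = p.@[fun i => o i + t * y i].
Proof.
rewrite -/(horner_eval t _) mmap_rmorph.
rewrite -[RHS]/(mmap idfun _ p).
rewrite /mmap; apply: eq_bigr => m _; congr (_ * _); first by rewrite /= /horner_eval hornerC.
by apply: eq_bigr => i _; rewrite /= /horner_eval !hornerE mulrC.
Qed.

Lemma mpoly_nonroot_near (F : numFieldType) (n : nat) (p : {mpoly F[n]}) (c : 'I_n -> F) (e : F) :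
  p != 0 -> 0 < e -> exists2 v, p.@[v] != 0 & forall i, `|v i - c i| < e.
Proof.
move=> /mpoly_exists_nonroot [w wP] e0.
pose y i := w i - c i.
have q0 : line_subst c y p != 0.
  apply: contraNneq wP => e'; have := horner_line_subst c y p 1; rewrite e' horner0 => ->.
  by apply/eqP/meval_eq => i; rewrite mul1r addrC subrK.
have s0 : 0 < 1 + \sum_i `|y i| by rewrite ltr_wpDr // sumr_ge0.
(* The bound on [t] makes every [t * y i] smaller than [e]; the summand 1 keeps the denominator
   positive. *)
have [t /andP [t0 te] tP] := exists_nonroot q0 (divr_gt0 e0 s0).
rewrite horner_line_subst in tP; exists (fun i => c i + t * y i) => // i.
rewrite addrC addKr normrM (gtr0_norm t0) -(divfK (lt0r_neq0 s0) e).
apply: (@le_lt_trans _ _ (t * (1 + \sum_i `|y i|))).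
  rewrite ler_pM2l // (bigD1 i) //= addrCA lerDl addr_ge0 // sumr_ge0 //.
by rewrite ltr_pM2r.
Qed.

Lemma mmap_ext (n : nat) (R S : comNzRingType) (f f' : R -> S) (h h' : 'I_n -> S) (p : {mpoly
  R[n]}) :
  f =1 f' -> h =1 h' -> mmap f h p = mmap f' h' p.
Proof.
by move=> ef eh; apply: eq_bigr => m _; rewrite ef; congr (_ * _); apply: eq_bigr => i _;
  rewrite eh.
Qed.

Lemma poly_series_div (R : comNzRingType) (a : R) (u v : {poly R}) (N : nat) :
  a * v`_0 = 1 ->
  exists q r : {poly R}, (size q <= N)%N /\ u = v * q + r * 'X^N.
Proof.
move=> av; elim: N => [|N [q [r [sq ->]]]].
  by exists 0, u; rewrite size_poly0 mulr0 add0r mulr1.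
have [r' r'E] : exists r', r - (a * r`_0) *: v = r' * 'X.
  have := poly_take_drop 1 (r - (a * r`_0) *: v).
  set w := (X in take_poly _ X).
  have -> : take_poly 1 w = 0.
    apply/polyP => -[|i]; rewrite coef_take_poly coef0 //=.
    by rewrite coefB coefZ mulrAC av mul1r subrr.
  by rewrite add0r expr1 => <-; eexists.
exists (q + (a * r`_0) *: 'X^N), r'; split.
  rewrite (leq_trans (size_polyD _ _)) // geq_max (leq_trans sq) //=.
  by rewrite (leq_trans (size_scale_leq _ _)) // size_polyXn.
rewrite exprS mulrA -r'E mulrDr -addrA; congr (_ + _).
by rewrite mulrBl -!mul_polyC; ring.
Qed.

(* On each line through a point o with v(o) <> 0, the restriction of u / v to the line
   is a polynomial of degree at most deg u, so the power series expansion of u / v at o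
   has no homogeneous term of degree larger than deg u. *)
Lemma mpoly_dvd_lines (F : numFieldType) (n : nat) (u v : {mpoly F[n]}) : v != 0 ->
  (forall o y, v.@[o] != 0 -> exists q, line_subst o y u = line_subst o y v * q) ->
  exists c, u = v * c.
Proof.
move=> /mpoly_exists_nonroot [o vo] dvd.
(* [s p] is [p] on the generic line through [o]: the variables ['X_i] form the direction, so the
   coefficient of degree i is the homogeneous part of degree i of [p] expanded at [o]. *)
pose s : {mpoly F[n]} -> {poly {mpoly F[n]}} :=
  mmap (polyC \o @mpolyC n F) (fun i => (o i)%:MP%:P + 'X_i *: 'X).
have sE y p : map_poly (meval y) (s p) = line_subst o y p.
  rewrite -[LHS]/((map_poly (meval y) : {rmorphism _ -> _}) _) mmap_rmorph.
  apply: mmap_ext => [c|i] /=; first by rewrite map_polyC /= mevalC.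
  by rewrite rmorphD /= map_polyZ map_polyC map_polyX /= mevalC mevalXU.
have s0 p : (s p)`_0 = (p.@[o])%:MP.
  rewrite -horner_coef0 -[LHS]/(horner_eval 0 (s p)) mmap_rmorph.
  rewrite -[meval o p]/(mmap idfun o p) mmap_rmorph.
  apply: mmap_ext => [c|i] /=; first by rewrite /horner_eval hornerC.
  by rewrite /horner_eval hornerD hornerC hornerZ hornerX mulr0 addr0.
have av : ((v.@[o])^-1)%:MP * (s v)`_0 = 1 by rewrite s0 -mpolyCM mulVf // mpolyC1.
have [Q [r [sQ uE]]] := poly_series_div (s u) (size (s u)) av.
(* The truncated series, evaluated at parameter 1 with direction z - o, is the quotient at z. *)
exists (mmap (@mpolyC n F) (fun i => 'X_i - (o i)%:MP) Q.[1]).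
apply: mpoly_ext => w; rewrite mevalM.
pose y i := w i - o i.
have ev p : p.@[w] = (line_subst o y p).[1].
  by rewrite horner_line_subst; apply: meval_eq => i; rewrite mul1r addrC subrK.
have -> : (mmap (@mpolyC n F) (fun i => 'X_i - (o i)%:MP) Q.[1]).@[w] =
          (map_poly (meval y) Q).[1].
  rewrite -[1 in RHS](rmorph1 (meval y)) horner_map /= mmap_rmorph.
  apply: mmap_ext => [c|i] /=; first by rewrite mevalC.
  by rewrite mevalB mevalXU mevalC.
have [q qE] := dvd o y vo; rewrite !ev -hornerM; congr _.[_].
set Qy := map_poly _ Q; set vy := line_subst o y v.
pose phi : {rmorphism _ -> _} := map_poly (meval y).
have e : phi (s u) = phi (s v) * phi Q + phi r * phi 'X^(size (s u)).
  by rewrite {1}uE rmorphD !rmorphM.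
have phiX k : phi 'X^k = 'X^k by exact: map_polyXn.
have {}e : vy * q = vy * Qy + phi r * 'X^(size (s u)).
  by rewrite -qE -sE -[vy]sE -phiX; exact: e.
have {}e : vy * (q - Qy) = phi r * 'X^(size (s u)).
  by rewrite mulrBr e addrAC subrr add0r.
have vy0 : vy.[0] != 0 by rewrite horner_line_subst; apply: contra_neq vo => <-;
  apply: meval_eq => i; rewrite mul0r addr0.
have vyn0 : vy != 0 by apply: contraNneq vy0 => ->; rewrite horner0.
(* Both [q] and [Qy] have size at most [size (s u)], so their difference can be divisible by this
   power of ['X] only if it is zero. *)
have : 'X^(size (s u)) %| (q - Qy).
  have := dvdp_mull (phi r) (dvdpp 'X^(size (s u))).
  rewrite -e mulrC Gauss_dvdpl // coprimep_sym coprimep_expr //.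
  by rewrite coprimepX /root.
have [/eqP|q0] := eqVneq (q - Qy) 0.
  by rewrite subr_eq0 => /eqP qQ _; rewrite qE qQ.
move=> /dvdp_leq -/(_ q0); rewrite size_polyXn ltnNge => /negP [].
rewrite (leq_trans (size_polyD _ _)) // geq_max size_polyN.
rewrite (leq_trans (size_poly _ _)) // andbT.
have [->|nq0] := eqVneq q 0; first by rewrite size_poly0.
apply: leq_trans (size_poly _ _ : size (map_poly (meval y) (s u)) <= _)%N.
by rewrite sE qE size_mul // -(prednK (_ : 0 < size vy)%N) ?leq_addl // lt0n size_poly_eq0.
Qed.

(** * Minimal polynomials over C[x] *)

Lemma poly_dvd_XsubC (F : fieldType) (r : F) (f : {poly {poly F}}) :
  map_poly (horner_eval r) f = 0 -> exists f', f = ('X - r%:P) *: f'.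
Proof.
move=> f0; exists (\poly_(i < size f) (f`_i %/ ('X - r%:P))).
apply/polyP => i; rewrite coefZ coef_poly; case: ltnP => [_|/(nth_default 0) ->];
  last by rewrite mulr0.
rewrite mulrC divpK // dvdp_XsubCl rootE.
by apply/eqP; have := congr1 (fun p : {poly F} => p`_i) f0; rewrite coef_map coef0.
Qed.

(** A form of Gauss's lemma, by induction on the degree of [e]: at a root r of [e], reduction modulo
    ['X - r] gives a product equal to zero in a domain, so ['X - r] divides [f] or [g] and can be
    cancelled. Once [e] is constant, comparing leading coefficients shows that the one of [f] is a
    unit. *)
Lemma gauss_monic_multiple (F : closedFieldType) (e : {poly F}) (f g h : {poly {poly F}}) :
  e != 0 -> h \is monic -> f * g = e *: h -> exists f', f = lead_coef f *: f'.
Proof.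
move=> e0 hm; have [k] := ubnP (size e); elim: k e f g e0 => // k IH e f g e0 /ltnSE sek fg.
have [s1|/closed_rootP [r re]] := eqVneq (size e) 1.
  have /size_poly1P [c c0 ec] : size e == 1 by apply/eqP.
  exists ((lead_coef g * (c^-1)%:P) *: f); rewrite scalerA mulrA -lead_coefM fg.
  by rewrite lead_coefZ (monicP hm) mulr1 ec -polyCM divff // scale1r.
have [e' eE] := factor_theorem e r re.
have e'0 : e' != 0 by apply: contraNneq e0 => z; rewrite eE z mul0r.
have X0 : ('X - r%:P : {poly F}) != 0 by rewrite polyXsubC_eq0.
have XI (a b : {poly {poly F}}) : ('X - r%:P) *: a = ('X - r%:P) *: b -> a = b.
  by rewrite -!mul_polyC; apply: mulfI; rewrite polyC_eq0.
have se' : (size e' < k)%N.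
  by apply: leq_trans sek; rewrite eE size_Mmonic ?monicXsubC // size_XsubC addn2.
have := congr1 (map_poly (horner_eval r)) fg.
rewrite rmorphM /= map_polyZ /= (_ : horner_eval r e = 0) ?scale0r; last exact/eqP.
move=> /eqP; rewrite mulf_eq0 => /orP [] /eqP /poly_dvd_XsubC [w wE].
  have [|w' w'E] := IH e' w g e'0 se'.
    by apply: XI; rewrite scalerAl -wE fg eE scalerA mulrC.
  by exists w'; rewrite wE lead_coefZ -scalerA -w'E.
apply: (IH e' f w e'0 se').
by apply: XI; rewrite scalerAr -wE fg eE scalerA mulrC.
Qed.

(** Polynomial rings are integrally closed, seen through lines. A relation [f] of least degree
    divides, by pseudo-division, a multiple [lead_coef f ^+ k *: f0] of the monic relation [f0]. On
    each line through a point where [lead_coef f] is nonzero, Gauss's lemma makes it divide every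
    coefficient of [f]; by [mpoly_dvd_lines] it does so globally, and the quotient is monic. *)
Lemma monic_minimal_poly (F : numClosedFieldType) (m : nat) (K : comNzRingType)
    (rho : {rmorphism {mpoly F[m]} -> K}) (h : K) :
  (forall x y : K, x * y = 0 -> x = 0 \/ y = 0) ->
  (forall u, rho u = 0 -> u = 0) -> integralOver rho h ->
  exists mu, [/\ mu \is monic, root (map_poly rho mu) h &
    forall g, root (map_poly rho g) h -> exists q, g = q * mu].
Proof.
move=> Kdom rho_inj [f0 f0m f0h].
pose P k := `[< exists f, [/\ f != 0, root (map_poly rho f) h & size f = k] >].
have exP : exists k, P k by exists (size f0); apply/asboolP; exists f0; rewrite monic_neq0.
case: (ex_minnP exP) => k /asboolP [f [fn0 fh <-]] fmin.
have minf g : root (map_poly rho g) h -> (size g < size f)%N -> g = 0.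
  move=> gh sg; apply/eqP; apply: contraLR sg => g0; rewrite -leqNgt; apply: fmin.
  by apply/asboolP; exists g.
have rootB a q b : root (map_poly rho a) h -> root (map_poly rho b) h -> root (map_poly rho (a -
  q * b)) h.
  by rewrite /root rmorphB rmorphM /= hornerD hornerN hornerM => /eqP -> /eqP ->;
    rewrite mulr0 subrr.
have lf0 : lead_coef f != 0 by rewrite lead_coef_eq0.
have [k' [Q fQ]] : exists k Q, f * Q = lead_coef f ^+ k *: f0.
  have E := Pdiv.Idomain.divp_eq f0 f.
  exists (scalp f0 f), (f0 %/ f).
  rewrite E mulrC [f0 %% f]minf ?addr0 ?ltn_modp //.
  rewrite (_ : f0 %% f = lead_coef f ^+ scalp f0 f *: f0 - f0 %/ f * f);
    last by rewrite E addrC addKr.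
  apply: rootB => //.
  by rewrite /root -mul_polyC rmorphM hornerM /= (eqP f0h) mulr0.
have dvdl i : exists c, f`_i = lead_coef f * c.
  apply: mpoly_dvd_lines => // o y lo.
  set s : {rmorphism _ -> _} := line_subst o y.
  have nz w : w.@[o] != 0 -> s w != 0.
    apply: contraNneq => w0; have := horner_line_subst o y w 0.
    by rewrite -[mmap _ _ _]/(s w) w0 horner0 => ->; apply/eqP/meval_eq => j; rewrite mul0r addr0.
  have sl0 := nz _ lo.
  have e0 : s (lead_coef f ^+ k') != 0 by rewrite rmorphXn expf_neq0.
  have f0s : map_poly s f0 \is monic by apply: monic_map.
  have [|f' f'E] := gauss_monic_multiple (f := map_poly s f) (g := map_poly s Q) e0 f0s.
    by rewrite -rmorphM fQ; exact: map_polyZ.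
  exists f'`_i; rewrite -[LHS]/(s _) -coef_map f'E coefZ lead_coef_map_eq //.
have /choice [c cE] := dvdl.
pose mu := \poly_(i < size f) c i.
have fmu : f = lead_coef f *: mu.
  apply/polyP => i; rewrite coefZ coef_poly; case: ltnP => [_|/(nth_default 0) ->];
    last by rewrite mulr0.
  exact: cE.
have mum : mu \is monic.
  apply/monicP; apply: (mulfI lf0); by rewrite mulr1 -lead_coefZ -fmu.
have muh : root (map_poly rho mu) h.
  move: fh; rewrite {1}fmu /root -mul_polyC rmorphM hornerM /= map_polyC hornerC => /eqP /Kdom
    [/rho_inj /eqP|->//].
  by rewrite (negbTE lf0).
have smu : size mu = size f by rewrite -(size_scale mu lf0) -fmu.
exists mu; split=> // g gh.
have := Pdiv.Idomain.divp_eq g mu; rewrite (monicP mum) expr1n scale1r => gE.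
exists (g %/ mu); rewrite {1}gE [g %% mu]minf ?addr0 // -?smu ?ltn_modp ?monic_neq0 //.
rewrite (_ : g %% mu = g - g %/ mu * mu); last by rewrite {2}gE addrC addKr.
exact: rootB.
Qed.

(** * Lying over *)

Lemma eigenvector_horner_mx (A : comNzRingType) (n : nat) (M : 'M[A]_n.+1) (v : 'cV[A]_n.+1) (a : A)
    (p : {poly A}) :
  M *m v = a *: v -> horner_mx M p *m v = p.[a] *: v.
Proof.
move=> Mv; elim/poly_ind: p => [|p c IH]; first by rewrite rmorph0 horner0 mul0mx scale0r.
rewrite rmorphD rmorphM /= horner_mx_X horner_mx_C mulmxDl -mulmxE -mulmxA Mv.
by rewrite -scalemxAr IH mul_scalar_mx scalerA -scalerDl !hornerE mulrC.
Qed.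

(* The determinant of j evaluated at the companion matrix of f vanishes in A, since that
   matrix has a as eigenvalue, but it is sent to 1 by phi. *)
Lemma lying_over_proper (R A F : comNzRingType) (rho : {rmorphism R -> A}) (phi : {rmorphism R
  -> F})
    (a : A) (j : {poly R}) :
  (forall r, rho r = 0 -> phi r = 0) -> integralOver rho a ->
  root (map_poly rho j) a -> map_poly phi j != 1.
Proof.
move=> ker [f fm fa] ja; apply/eqP => j1.
have [N sf] : exists N, size f = N.+2.
  move: fm fa; case E : (size f) => [|[|N]]; last by exists N.
    by move/monic_neq0; rewrite -size_poly_eq0 E.
  move=> fm; rewrite (size1_polyC (eq_leq E)) in fm *.
  by move/monicP: fm; rewrite lead_coefC => ->; rewrite map_polyC /= rmorph1 /root hornerC oner_eq0.
pose M : 'M[R]_N.+1 := \matrix_(i, k) (if i == ord_max then - f`_k else (i.+1 == k)%:R).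
pose v : 'cV[A]_N.+1 := \col_i a ^+ i.
have Mv : map_mx rho M *m v = a *: v.
  apply/colP => i; rewrite !mxE.
  have [->|/eqP ni] := eqVneq i ord_max.
    have := eqP fa; rewrite horner_coef size_map_poly_id0;
      last by rewrite (monicP fm) rmorph1 oner_neq0.
    rewrite sf big_ord_recr /= coef_map /=.
    have -> : f`_N.+1 = 1 by rewrite -(monicP fm) lead_coefE sf.
    rewrite rmorph1 mul1r -exprS => /eqP; rewrite addr_eq0 => /eqP e.
    apply: oppr_inj; rewrite -e -sumrN; apply: eq_bigr => k _.
    by rewrite !mxE eqxx rmorphN mulNr opprK coef_map.
  have li : (i.+1 < N.+1)%N.
    by rewrite ltnS ltn_neqAle -ltnS ltn_ord andbT; apply/eqP => e; apply: ni; apply/val_inj.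
  rewrite (bigD1 (Ordinal li)) //= big1 => [|k kn].
    by rewrite !mxE (negbTE (introN eqP ni)) eqxx rmorph1 mul1r addr0 exprS.
  rewrite !mxE (negbTE (introN eqP ni)) (_ : (i.+1 == k) = false) ?rmorph0 ?mul0r //.
  by apply: contraNF kn => /eqP e; apply/eqP/val_inj.
have : rho (\det (horner_mx M j)) = 0.
  rewrite -det_map_mx map_horner_mx.
  set B := horner_mx _ _.
  have Bv : B *m v = 0 by rewrite (eigenvector_horner_mx _ Mv) (eqP ja) scale0r.
  (* The adjugate turns [B *m v = 0] into det B times v = 0; its entry of index 0 is det B, because
     v starts with a^0 = 1. *)
  have := congr1 (mulmx (\adj B)) Bv.
  rewrite mulmxA mul_adj_mx mul_scalar_mx mulmx0 => /colP /(_ ord0).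
  by rewrite !mxE expr0 mulr1.
move/ker; rewrite -det_map_mx map_horner_mx j1 rmorph1 det1 => /eqP.
by rewrite oner_eq0.
Qed.

(** As [phi] is onto, the images under [phi] of the polynomials killing [a] form an ideal of F[X].
    It is proper by [lying_over_proper], and a generator of it, the image of the [f] chosen below,
    has a root [t]. *)
Lemma extend_point_root (R A : comNzRingType) (F : closedFieldType) (rho : {rmorphism R -> A})
    (phi : {rmorphism R -> F}) (a : A) :
  (forall r, rho r = 0 -> phi r = 0) -> (forall c, exists r, phi r = c) -> integralOver rho a ->
  exists t, forall j, root (map_poly rho j) a -> root (map_poly phi j) t.
Proof.
move=> ker /choice [s sK] ia; have [f0 f0m f0a] := ia.
pose P k := `[< exists f, [/\ map_poly phi f != 0, root (map_poly rho f) a & size (map_poly phi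
  f) = k] >].
have exP : exists k, P k.
  by exists (size (map_poly phi f0)); apply/asboolP; exists f0; rewrite ?monic_neq0 ?monic_map.
case: (ex_minnP exP) => k /asboolP [f [fn0 fa <-]] fmin.
pose lift (q : {poly F}) := \poly_(i < size q) s q`_i.
have liftK q : map_poly phi (lift q) = q.
  apply/polyP => i; rewrite coef_map coef_poly; case: ltnP => /= [_|h]; first exact: sK.
  by rewrite rmorph0 nth_default.
have rootM q : root (map_poly rho (q * f)) a.
  by rewrite rmorphM /root hornerM /= (eqP fa) mulr0.
have [s1|/closed_rootP [t ft]] := eqVneq (size (map_poly phi f)) 1.
  have := lying_over_proper ker ia (rootM (lift (map_poly phi f)^-1)).
  rewrite rmorphM /= liftK mulVr ?eqxx //.
  have /size_poly1P [c c0 fc] : size (map_poly phi f) == 1 by apply/eqP.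
  by rewrite poly_unitE s1 fc coefC eqxx unitfE.
exists t => j ja.
have : root (map_poly rho (j - lift (map_poly phi j %/ map_poly phi f) * f)) a.
  by rewrite rmorphB /root hornerD hornerN (eqP ja) (eqP (rootM _)) subrr.
set r := (X in root (map_poly rho X) a) => ra.
have rE : map_poly phi r = map_poly phi j %% map_poly phi f.
  by rewrite /r rmorphB rmorphM /= liftK {1}(divp_eq (map_poly phi j) (map_poly phi f)) addrC addKr.
have r0 : map_poly phi r = 0.
  apply/eqP; apply: contraT => rn0.
  have := ltn_modp (map_poly phi j) (map_poly phi f); rewrite fn0 -rE ltnNge => /negP [].
  by apply: fmin; apply/asboolP; exists r.
have {}r0 : map_poly phi j %% map_poly phi f = 0 by rewrite -rE.
by rewrite (divp_eq (map_poly phi j) (map_poly phi f)) r0 addr0 /root hornerM (eqP ft) mulr0.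
Qed.

(** The elements of [s] are adjoined one at a time. [R1] is an iterated polynomial ring over [R]
    rather than a subring of [A]: both maps are then evaluations, and only the inclusion of kernels
    has to be maintained. *)
Lemma extend_point (A : comNzRingType) (F : closedFieldType) (s : seq A) (R : comNzRingType)
    (rho : {rmorphism R -> A}) (phi : {rmorphism R -> F}) :
  (forall r, rho r = 0 -> phi r = 0) -> (forall c, exists r, phi r = c) ->
  (forall a, a \in s -> integralOver rho a) ->
  exists (R1 : comNzRingType) (iota : {rmorphism R -> R1})
         (rho1 : {rmorphism R1 -> A}) (phi1 : {rmorphism R1 -> F}),
    [/\ forall r, rho1 (iota r) = rho r, forall r, phi1 (iota r) = phi r,
        forall r, rho1 r = 0 -> phi1 r = 0 & forall a, a \in s -> exists r, rho1 r = a].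
Proof.
elim: s R rho phi => [|a s IH] R rho phi ker surj int.
  by exists R, idfun, rho, phi; split.
have [t tP] := extend_point_root ker surj (int a (mem_head _ _)).
pose rho' : {rmorphism {poly R} -> A} := horner_eval a \o map_poly rho.
pose phi' : {rmorphism {poly R} -> F} := horner_eval t \o map_poly phi.
have rhoC r : rho' r%:P = rho r by rewrite /rho' /= map_polyC /horner_eval hornerC.
have phiC r : phi' r%:P = phi r by rewrite /phi' /= map_polyC /horner_eval hornerC.
have ker' r : rho' r = 0 -> phi' r = 0 by move=> /eqP /tP /eqP.
have surj' c : exists r, phi' r = c by have [r <-] := surj c; exists r%:P.
have int' b : b \in s -> integralOver rho' b.
  move=> bs; have [|f fm fb] := int b; first by rewrite inE bs orbT.
  exists (map_poly polyC f); first exact: monic_map.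
  rewrite -map_poly_comp (_ : map_poly _ f = map_poly rho f) //.
  exact: eq_map_poly.
have [R1 [iota [rho1 [phi1 [h1 h2 h3 h4]]]]] := IH _ rho' phi' ker' surj' int'.
exists R1, (iota \o polyC : {rmorphism R -> R1}), rho1, phi1; split=> // [r|r|b].
- by rewrite /= h1.
- by rewrite /= h2.
rewrite inE => /orP [/eqP ->|/h4 //]; exists (iota 'X).
by rewrite h1 /rho' /= map_polyX /horner_eval hornerX.
Qed.

Lemma meval_subst (F : comNzRingType) (n m : nat) (x : 'I_m -> {mpoly F[n]}) (u : {mpoly F[m]}) z :
  (subst x u).@[z] = u.@[fun i => (x i).@[z]].
Proof. by rewrite mmap_rmorph; apply: mmap_ext => [c|i] //=; rewrite mevalC. Qed.

(** The pair (b, t) is a point of the ring F[x][H], presented as [{poly {mpoly F[m]}}], because the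
    relations of [H] are the multiples of [mu]. Lying over extends it to all the coordinates, and
    their values form z. *)
Lemma lift_point (F : closedFieldType) (n m : nat) (K : comNzRingType)
    (theta : {rmorphism {mpoly F[n]} -> K}) (x : 'I_m -> {mpoly F[n]}) (H : {mpoly F[n]})
    (mu : {poly {mpoly F[m]}}) (b : 'I_m -> F) (t : F) :
  (forall j, integralOver (theta \o subst x) (theta 'X_j)) ->
  (forall g, root (map_poly (theta \o subst x) g) (theta H) -> exists q, g = q * mu) ->
  root (map_poly (meval b) mu) t ->
  exists z, [/\ forall f, theta f = 0 -> f.@[z] = 0, forall i, (x i).@[z] = b i & H.@[z] = t].
Proof.
move=> int mumin mut.
pose rho : {rmorphism {mpoly F[m]} -> K} := theta \o subst x.
pose rho0 : {rmorphism {poly {mpoly F[m]}} -> K} := horner_eval (theta H) \o map_poly rho.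
pose phi0 : {rmorphism {poly {mpoly F[m]}} -> F} := horner_eval t \o map_poly (meval b).
have rhoC r : rho0 r%:P = rho r by rewrite /rho0 /= map_polyC /horner_eval hornerC.
have phiC r : phi0 r%:P = r.@[b] by rewrite /phi0 /= map_polyC /horner_eval hornerC.
have ker r : rho0 r = 0 -> phi0 r = 0.
  by move=> /eqP /mumin [q ->]; rewrite rmorphM; rewrite [phi0 mu](eqP mut) mulr0.
have surj c : exists r, phi0 r = c by exists (c%:MP)%:P; rewrite phiC mevalC.
have int0 a : a \in [seq theta 'X_j | j : 'I_n] -> integralOver rho0 a.
  move=> /mapP [j _ ->]; have [f fm fj] := int j.
  exists (map_poly polyC f); first exact: monic_map.
  rewrite -map_poly_comp (_ : map_poly _ f = map_poly rho f) //.
  exact: eq_map_poly.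
have [R1 [iota [rho1 [phi1 [h1 h2 h3 h4]]]]] := extend_point ker surj int0.
have /choice [r rE] : forall j, exists r, rho1 r = theta 'X_j.
  by move=> j; apply: h4; apply: map_f; rewrite mem_enum.
pose psi : {rmorphism {mpoly F[n]} -> R1} := mmap (iota \o polyC \o @mpolyC m F) r.
pose z j := phi1 (r j).
have rpsi : forall f, rho1 (psi f) = theta f.
  apply: (@rmorph_mpoly_ext n F K (rho1 \o psi) theta) => [c|j] /=.
    by rewrite /psi mmapC /= h1 rhoC /rho /= mmapC.
  by rewrite /psi mmapX mmap1U rE.
have ppsi : forall f, phi1 (psi f) = f.@[z].
  apply: (@rmorph_mpoly_ext n F F (phi1 \o psi) (meval z)) => [c|j] /=.
    by rewrite /psi mmapC /= h2 phiC !mevalC.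
  by rewrite /psi mmapX mmap1U mevalXU.
exists z; split=> [f f0|i|].
- by rewrite -ppsi; apply: h3; rewrite rpsi.
- apply/eqP; rewrite -subr_eq0 -ppsi; apply/eqP.
  have -> : b i = phi1 (iota ('X_i)%:P) by rewrite h2 phiC mevalXU.
  by rewrite -rmorphB; apply: h3; rewrite rmorphB rpsi h1 rhoC /rho /= mmapX mmap1U subrr.
apply/eqP; rewrite -subr_eq0 -ppsi; apply/eqP.
have -> : t = phi1 (iota 'X) by rewrite h2 /phi0 /= map_polyX /horner_eval hornerX.
by rewrite -rmorphB; apply: h3;
  rewrite rmorphB rpsi h1 /rho0 /= map_polyX /horner_eval hornerX subrr.
Qed.

(** * Noether normalization *)

Lemma mpoly_ring_ind (n : nat) (R : comNzRingType) (P : {mpoly R[n]} -> Prop) :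
  (forall c, P c%:MP) -> (forall i, P 'X_i) ->
  (forall p q, P p -> P q -> P (p + q)) -> (forall p q, P p -> P q -> P (p * q)) ->
  forall p, P p.
Proof.
move=> PC PX PD PM p; have P1 : P 1 by rewrite -mpolyC1; apply: PC.
rewrite (mpolyE p); apply: (big_ind P) => // [|m _]; first by rewrite -mpolyC0; apply: PC.
rewrite -mul_mpolyC; apply: (PM _ _) => //; rewrite mpolyXE_id.
apply: (big_ind P) => [//|p' q' hp hq|i _]; first exact: PM.
by elim: (m i) => [|k IH]; rewrite ?expr0 // exprS; apply: PM.
Qed.

(** The bound and the Lipschitz estimate are proved together because the estimate for a product uses
    the bounds of its factors. *)
Lemma mpoly_lipschitz (F : numFieldType) (n : nat) (f : {mpoly F[n]}) :
  exists2 L, 0 < L & forall z, (forall j, `|z j| <= 1) -> `|f.@[z]| <= L /\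
    forall w e, 0 <= e -> (forall j, `|w j| <= 1) -> (forall j, `|z j - w j| <= e) ->
      `|f.@[z] - f.@[w]| <= L * e.
Proof.
move: f; apply: mpoly_ring_ind => [c|i|p q [L L0 HL] [M M0 HM]|p q [L L0 HL] [M M0 HM]].
- exists (1 + `|c|) => [|z hz]; first by rewrite ltr_wpDr.
  split=> [|w e e0 hw hzw]; rewrite !mevalC; first by rewrite lerDr.
  by rewrite subrr normr0 mulr_ge0 ?addr_ge0.
- exists 1 => // z hz; rewrite !mevalXU; split=> [|w e e0 _ h]; first exact: hz.
  by rewrite mevalXU mul1r.
- exists (L + M) => [|z hz]; first exact: addr_gt0.
  have [bz lz] := HL z hz; have [bz' lz'] := HM z hz.
  split=> [|w e e0 hw h]; rewrite !mevalD; first by rewrite (le_trans (ler_normD _ _)) // lerD.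
  by rewrite opprD addrACA mulrDl (le_trans (ler_normD _ _)) // lerD // ?lz ?lz'.
exists (L * M + L * M) => [|z hz]; first by rewrite addr_gt0 ?mulr_gt0.
have [bz lz] := HL z hz; have [bz' lz'] := HM z hz.
split=> [|w e e0 hw h]; rewrite !mevalM.
  by rewrite normrM (le_trans (ler_pM _ _ bz bz')) // lerDl mulr_ge0 // ltW.
have [bw _] := HM w hw.
have -> : p.@[z] * q.@[z] - p.@[w] * q.@[w] = p.@[z] * (q.@[z] - q.@[w]) + (p.@[z] - p.@[w]) *
  q.@[w] by ring.
rewrite (le_trans (ler_normD _ _)) // !normrM mulrDl lerD //.
  by rewrite -mulrA ler_pM // lz'.
by rewrite mulrAC ler_pM // lz.
Qed.

Lemma coef_top_mul (R : comNzRingType) (p q : {poly R}) (k l : nat) :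
  (size p <= k.+1)%N -> (size q <= l.+1)%N -> (p * q)`_(k + l) = p`_k * q`_l.
Proof.
move=> sp sq; have lk : (k < (k + l).+1)%N by rewrite ltnS leq_addr.
rewrite coefM (bigD1 (Ordinal lk)) //= addKn big1 ?addr0 // => i ik.
have [lik|lki|e] := ltngtP i k; last by case/eqP: ik; apply/val_inj.
- by rewrite [q`__]nth_default ?mulr0 // (leq_trans sq) // ltn_subRL ltn_add2r.
- by rewrite [p`__]nth_default ?mul0r // (leq_trans sp).
Qed.

(* Subtracting multiples of the last generator makes a relation f between the generators
   monic in that generator, up to the value at mu of the leading form of f. *)
Lemma monic_change_of_variables (F : fieldType) (m : nat) (mu : 'I_m.+2 -> F) (f : {mpoly
  F[m.+2]}) :
  let Y (i : 'I_m.+2) : {poly {mpoly F[m.+1]}} := if unlift ord_max i is Some j then ('X_j)%:P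
    else 0 in
  let G := mmap (polyC \o @mpolyC m.+1 F) (fun i => Y i + (mu i)%:MP *: 'X) f in
  let d := (msize f).-1 in
  f != 0 -> (size G <= d.+1)%N /\
  G`_d = ((\sum_(k <- msupp f | mdeg k == d) f@_k *: 'X_[k]).@[mu])%:MP.
Proof.
move=> Y G d f0; pose h i := Y i + (mu i)%:MP *: 'X.
have top (k : 'X_{1..m.+2}) : (size (mmap1 h k) <= (mdeg k).+1)%N /\
    (mmap1 h k)`_(mdeg k) = (\prod_i mu i ^+ k i)%:MP.
  (* [Q p e c]: degree at most [e], with the constant [c] as coefficient of degree [e]. This is
     stable under products. *)
  pose Q (p : {poly {mpoly F[m.+1]}}) (e : nat) (c : F) := (size p <= e.+1)%N /\ p`_e = c%:MP.
  have QM p e c p' e' c' : Q p e c -> Q p' e' c' -> Q (p * p') (e + e')%N (c * c').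
    move=> [s1 c1] [s2 c2]; split; last by rewrite coef_top_mul // c1 c2 -mpolyCM.
    rewrite (leq_trans (size_polyMleq _ _)) // -subn1 leq_subLR add1n.
    by rewrite (leq_trans (leq_add s1 s2)) // addSn addnS.
  rewrite mdegE /mmap1.
  apply: (big_ind3 Q) => [|p e c p' e' c'|i _].
  - by split; rewrite ?size_poly1 // coefC eqxx mpolyC1.
  - exact: QM.
  have Qi : Q (Y i + (mu i)%:MP *: 'X) 1%N (mu i).
    have sY : (size (Y i) <= 1)%N 
      by rewrite /Y; case: unlift => [j|]; [exact: size_polyC_leq1|rewrite size_poly0].
    split; last by rewrite coefD coefZ coefX mulr1 nth_default // add0r.
    rewrite (leq_trans (size_polyD _ _)) // geq_max (leq_trans sY) //=.
    by rewrite (leq_trans (size_scale_leq _ _)) // size_polyX.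
  elim: (k i) => [|e IH]; first by rewrite !expr0; split; rewrite ?size_poly1 // coefC eqxx mpolyC1.
  by rewrite !exprS; apply: (QM _ 1%N _ _ e).
have sd k : k \in msupp f -> (mdeg k <= d)%N.
  by move=> kf; rewrite -ltnS prednK ?lt0n ?msize_poly_eq0 // msize_mdeg_lt.
split.
  rewrite /G /mmap big_seq; apply: (big_ind (fun p : {poly _} => (size p <= d.+1)%N)).
  - by rewrite size_poly0.
  - by move=> p q sp sq; rewrite (leq_trans (size_polyD _ _)) // geq_max sp.
  move=> k kf; rewrite mul_polyC (leq_trans (size_scale_leq _ _)) //.
  by have [s _] := top k; rewrite (leq_trans s) // ltnS sd.
rewrite /G /mmap coef_sum (raddf_sum (meval mu)) (raddf_sum (@mpolyC m.+1 F)) [RHS]big_mkcond /=.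
rewrite big_seq [RHS]big_seq; apply: eq_bigr => k kf.
rewrite mul_polyC coefZ; have [s c] := top k.
have [e|ne] := eqVneq (mdeg k) d; first by rewrite -e c -mpolyCM mevalZ mevalX.
rewrite nth_default ?mulr0 // (leq_trans s) // ltn_neqAle ne; exact: sd.
Qed.

(** With [mu] off the zeros of the leading form [g] of the relation, [x'] = x_last / mu_last is
    integral over the functions y_j = x_j - mu_j x'. Taking [mu] close to the last unit vector makes
    mu_0 / mu_last, the change of [x ord0], as small as required. *)
Lemma noether_step (F : numFieldType) (n m : nat) (K : comNzRingType)
    (theta : {rmorphism {mpoly F[n]} -> K}) (x : 'I_m.+2 -> {mpoly F[n]}) (f : {mpoly F[m.+2]})
      (e : F) :
  (forall j, integralOver (theta \o subst x) (theta 'X_j)) ->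
  f != 0 -> theta (subst x f) = 0 -> 0 < e ->
  exists y : 'I_m.+1 -> {mpoly F[n]},
    (forall j, integralOver (theta \o subst y) (theta 'X_j)) /\
    exists2 c, `|c| <= e & y ord0 = x ord0 - c *: x ord_max.
Proof.
move=> intx f0 fx e0; pose d := (msize f).-1.
pose g := \sum_(k <- msupp f | mdeg k == d) f@_k *: 'X_[k].
have g0 : g != 0.
  have lf := mlead_supp f0.
  apply: contraTneq lf => g0; have := congr1 (mcoeff (mlead f)) g0.
  rewrite mcoeff0 /g -big_filter raddf_sum /= (bigD1_seq (mlead f)) ?filter_uniq ?msupp_uniq
    //=; last first.
    by rewrite mem_filter mlead_supp // andbT /d -(mlead_deg f0).
  rewrite mcoeffZ mcoeffX eqxx mulr1 big1 ?addr0 => [/eqP|k /negbTE kn].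
    by rewrite mcoeff_eq0.
  by rewrite mcoeffZ mcoeffX kn mulr0.
(* Both 2e' <= 1 and 2e' <= e are needed: the first gives |mu_last| >= 1/2, and then |mu_0| < e' <=
   e/2 <= e |mu_last|. *)
pose e' := e / (1 + e) / 2.
have e10 : 0 < 1 + e by rewrite addr_gt0.
have e'0 : 0 < e' by rewrite !divr_gt0.
have e2 : 2 * e' = e / (1 + e) by rewrite /e' mulrCA divff ?mulr1 // pnatr_eq0.
have e'1 : 2 * e' <= 1 by rewrite e2 ler_pdivrMr // mul1r lerDr.
have e'e : 2 * e' <= e by rewrite e2 ler_pdivrMr // ler_peMr ?lerDl // ltW.
have [mu gmu mue] := mpoly_nonroot_near (fun i => (i == ord_max)%:R) g0 e'0.
pose ml := mu ord_max.
have ml2 : 1 <= 2 * `|ml|.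
  have := mue ord_max; rewrite eqxx => /ltW h.
  have : 1 <= `|ml| + e'.
    by rewrite -{1}(normr1 F) -(subrK ml 1) addrC (le_trans (ler_normD _ _)) // lerD2l distrC.
  move=> h1; have : 2 * 1 <= 2 * (`|ml| + e') by rewrite ler_pM2l.
  rewrite mulrDr => h2; rewrite -(lerD2r 1); apply: le_trans (le_trans h2 _);
    first by rewrite mulr1.
  by rewrite lerD2l.
have ml0 : ml != 0 by apply: contraTneq ml2 => ->; rewrite normr0 mulr0 ler10.
pose x' := ml^-1 *: x ord_max.
pose y j := x (lift ord_max j) - mu (lift ord_max j) *: x'.
pose rho : {rmorphism {mpoly F[m.+1]} -> K} := theta \o subst y.
have rhoC c : rho c%:MP = theta c%:MP by rewrite /rho /= mmapC.
have rhoX j : rho 'X_j = theta (y j) by rewrite /rho /= mmapX mmap1U.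
pose Y (i : 'I_m.+2) : {poly {mpoly F[m.+1]}} := if unlift ord_max i is Some j then ('X_j)%:P
  else 0.
pose G := mmap (polyC \o @mpolyC m.+1 F) (fun i => Y i + (mu i)%:MP *: 'X) f.
have [sG cG] : (size G <= d.+1)%N /\ G`_d = (g.@[mu])%:MP := monic_change_of_variables mu f0.
(* [G] is the relation [f] rewritten through x_i = y_i + mu_i x', where the last y is 0. *)
have rootG : root (map_poly rho G) (theta x').
  pose ev : {rmorphism _ -> K} := horner_eval (theta x') \o map_poly rho.
  have evC u : ev u%:P = rho u by rewrite /ev /= map_polyC /horner_eval hornerC.
  have evX : ev 'X = theta x' by rewrite /ev /= map_polyX /horner_eval hornerX.
  apply/eqP; rewrite -[LHS]/(ev G) mmap_rmorph -fx -[RHS]/((theta \o subst x) f).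
  rewrite [RHS]mmap_rmorph; apply: mmap_ext => [c|i]; first by rewrite -[LHS]/(ev _%:P) evC rhoC.
  rewrite -[LHS]/(ev (Y i + (mu i)%:MP *: 'X)) -mul_polyC rmorphD rmorphM evC evX rhoC -rmorphM.
  rewrite /Y mul_mpolyC; case: unliftP => [j ->|->].
    by rewrite evC rhoX -rmorphD subrK.
  by rewrite rmorph0 add0r scalerA divff // scale1r.
have intC c : integralOver rho (theta c%:MP) by rewrite -rhoC; apply: integral_id.
have intx' : integralOver rho (theta x').
  have gi : ((g.@[mu])^-1)%:MP * (g.@[mu])%:MP = 1 :> {mpoly F[m.+1]} by rewrite -mpolyCM mulVf
    // mpolyC1.
  exists (((g.@[mu])^-1)%:MP *: G).
    have sZ : (size (((g.@[mu])^-1)%:MP *: G) <= d.+1)%N by rewrite (leq_trans (size_scale_leq _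
      _)).
    have cZ : (((g.@[mu])^-1)%:MP *: G)`_d = 1 by rewrite coefZ cG.
    apply/monicP; rewrite lead_coefE.
    have -> // : size (((g.@[mu])^-1)%:MP *: G) = d.+1.
    apply/eqP; rewrite eqn_leq sZ ltnNge; apply/negP => /(nth_default 0) /eqP.
    by rewrite cZ oner_eq0.
  by rewrite /root -mul_polyC rmorphM hornerM /= (eqP rootG) mulr0.
have intxi i : integralOver rho (theta (x i)).
  case: (unliftP ord_max i) => [j|] ->.
    rewrite -(subrK (mu (lift ord_max j) *: x') (x _)) rmorphD -/(y j) -rhoX.
    apply: integral_add; first exact: integral_id.
    by rewrite -mul_mpolyC rmorphM; apply: integral_mul.
  have -> : x ord_max = ml%:MP * x' by rewrite mul_mpolyC scalerA divff // scale1r.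
  by rewrite rmorphM; apply: integral_mul.
have intu u : integralOver rho ((theta \o subst x) u).
  move: u; apply: mpoly_ring_ind => [c|i|p q ip iq|p q ip iq].
  - by rewrite /= mmapC; exact: intC.
  - by rewrite /= mmapX mmap1U; exact: intxi.
  - by rewrite rmorphD; apply: integral_add.
  by rewrite rmorphM; apply: integral_mul.
exists y; split=> [j|].
  have [p pm pj] := intx j.
  apply: (integral_root_monic (p := map_poly (theta \o subst x) p)) => //; first exact: monic_map.
  by apply/integral_poly => i; rewrite coef_map; exact: intu.
exists (mu ord0 / ml).
  have := mue ord0; rewrite (_ : (ord0 == ord_max) = false) // subr0 => h.
  rewrite normrM normfV ler_pdivrMr ?normr_gt0 //.
  have : e' <= e * `|ml|; last exact: le_trans (ltW h).
  have two0 : 0 < 2 :> F by [].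
  rewrite -(ler_pM2l two0) [leRHS]mulrCA.
  by apply: (le_trans e'e); rewrite ler_peMr // ltW.
rewrite /y /x' scalerA; have -> // : lift ord_max ord0 = ord0 :> 'I_m.+2 by apply/val_inj.
Qed.

(** Iterates [noether_step] until no relation or only one function is left. Each step spends at most
    half of the distance that separates [x ord0] on [T] from its value at [p]; [T] will be the
    torus. *)
Lemma noether_normalization (F : numFieldType) (n m : nat) (K : comNzRingType)
    (theta : {rmorphism {mpoly F[n]} -> K}) (x : 'I_m.+1 -> {mpoly F[n]})
    (T : ('I_n -> F) -> Prop) (p : 'I_n -> F) (delta : F) :
  (forall j, integralOver (theta \o subst x) (theta 'X_j)) ->
  (forall j, `|p j| <= 1) -> (forall z, T z -> forall j, `|z j| <= 1) ->
  0 < delta -> (forall z, T z -> delta <= `|(x ord0).@[z] - (x ord0).@[p]|) ->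
  exists (k : nat) (y : 'I_k.+1 -> {mpoly F[n]}),
    [/\ forall j, integralOver (theta \o subst y) (theta 'X_j),
        k = 0%N \/ (forall u, theta (subst y u) = 0 -> u = 0) &
        exists2 delta', 0 < delta' &
          forall z, T z -> delta' <= `|(y ord0).@[z] - (y ord0).@[p]|].
Proof.
move=> + p1 T1; elim: m x delta => [|m IH] x delta intx d0 dP.
  by exists 0%N, x; split; [|left|exists delta].
have [inj|/existsNP [f /not_implyP [fx /eqP f0]]] := pselect (forall u, theta (subst x u) = 0 ->
  u = 0).
  by exists m.+1, x; split; [|right|exists delta].
have [L L0 HL] := mpoly_lipschitz (x ord_max).
have L4 : 0 < 4 * L by rewrite mulr_gt0.
(* On the closed polydisc |x_last| <= L, so two of its values differ by at most 2L, and the factor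
   delta / (4L) costs at most delta / 2. *)
have [y [inty [c cle y0]]] := noether_step intx f0 fx (divr_gt0 d0 L4).
apply: (IH y (delta / 2) inty); first by rewrite divr_gt0.
move=> z Tz; rewrite y0 !mevalB !mevalZ.
have b : `|c * ((x ord_max).@[z] - (x ord_max).@[p])| <= delta / 2.
  rewrite normrM; apply: (@le_trans _ _ (delta / (4 * L) * (L + L))).
    rewrite ler_pM // (le_trans (ler_normB _ _)) // lerD //.
      by have [] := HL z (T1 z Tz).
    by have [] := HL p p1.
  suff -> : delta / (4 * L) * (L + L) = delta / 2 by [].
  by field; rewrite lt0r_neq0.
have -> : (x ord0).@[z] - c * (x ord_max).@[z] - ((x ord0).@[p] - c * (x ord_max).@[p]) =
  ((x ord0).@[z] - (x ord0).@[p]) - c * ((x ord_max).@[z] - (x ord_max).@[p]) by ring.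
apply: le_trans (lerB_dist _ _); rewrite lerBrDr.
apply: le_trans (dP z Tz); by rewrite [leRHS](splitr delta) lerD2l.
Qed.

(** * Continuity of roots *)

(** |p(z)| is the product of the distances from z to the roots, hence at least [e ^+ (size p).-1] if
    all of them are at least [e]. *)
Lemma monic_near_root (F : numClosedFieldType) (p : {poly F}) (z e : F) :
  p \is monic -> 0 < e -> `|p.[z]| < e ^+ (size p).-1 -> exists2 r, root p r & `|z - r| < e.
Proof.
move=> pm e0; have [rs pE] := closed_field_poly_normal p.
move: pE; rewrite (monicP pm) scale1r => pE; rewrite pE size_prod_XsubC /= => lt.
have [/hasP [r rrs zr]|/hasPn h] := boolP (has (fun r => `|z - r| < e) rs).
  by exists r => //; rewrite root_prod_XsubC.
suff : e ^+ size rs <= `|(\prod_(r <- rs) ('X - r%:P)).[z]| by move/le_lt_trans/(_ lt);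
  rewrite ltxx.
elim: rs h {pE lt} => [|r rs IH] h; first by rewrite big_nil hornerC normr1.
rewrite big_cons hornerM normrM hornerXsubC exprS ler_pM ?exprn_ge0 ?(ltW e0) //.
  by rewrite real_leNgt ?normr_real ?gtr0_real // h ?mem_head.
by apply: IH => x xs; apply: h; rewrite inE xs orbT.
Qed.

Lemma monic_root_bound (F : numFieldType) (p : {poly F}) (z c : F) :
  p \is monic -> root p z -> (forall i, `|p`_i| <= c) -> `|z| <= 1 + c *+ size p.
Proof.
move=> pm pz pc; have c0 : 0 <= c by exact: le_trans (normr_ge0 _) (pc 0%N).
have [z1|z1] := real_leP (normr_real z) (ger0_real ler01); first by rewrite ler_wpDr ?mulrn_wge0.
move: pz pm; case E : (size p) => [|[|d]].
- by move=> _ /monic_neq0; rewrite -size_poly_eq0 E.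
- rewrite (size1_polyC (eq_leq E)) rootC => /eqP -> /monicP /eqP.
  by rewrite lead_coefC eq_sym oner_eq0.
move=> /eqP; rewrite horner_coef E big_ord_recr /= => + /monicP.
rewrite lead_coefE E /= => + p1; rewrite p1 mul1r addrC => /eqP; rewrite addr_eq0 => /eqP e.
have zn : 0 < `|z| ^+ d by rewrite exprn_gt0 // (lt_trans ltr01).
have : `|z| * `|z| ^+ d <= (c *+ d.+2) * `|z| ^+ d.
  rewrite -exprS -normrX e normrN (le_trans (ler_norm_sum _ _ _)) //.
  apply: (@le_trans _ _ (\sum_(i < d.+1) c * `|z| ^+ d)).
    apply: ler_sum => i _; rewrite normrM normrX ler_pM ?exprn_ge0 //.
    by rewrite ler_weXn2l ?(ltW z1) // -ltnS.
  rewrite sumr_const card_ord -mulrnAl ler_pM2r //.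
  by rewrite [leRHS]mulrS lerDr.
rewrite ler_pM2r // => /le_trans; apply; by rewrite lerDr.
Qed.

(** An element of [{poly {poly F}}] is a family of polynomials in the outer variable with the inner
    variable as parameter; [at_ s] takes its member at [s]. *)
Local Notation at_ s := (map_poly (horner_eval s)).

Lemma poly2_coef_bound (F : numFieldType) (Q : {poly {poly F}}) (b : F) :
  exists2 M, 0 < M & forall s, `|s| <= b -> forall i, `|(at_ s Q)`_i| <= M.
Proof.
elim/poly_ind: Q => [|Q c [M M0 HM]].
  by exists 1 => // s _ i; rewrite map_poly0 coef0 normr0.
have [ub ubP] := poly_disk_bound c b.
exists (M + `|ub|) => [|s sb i]; first by rewrite ltr_wpDr.
have ub0 := ubP s sb.
rewrite coef_map coefD coefMX coefC /=; case: i => [|i] /=.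
  by rewrite add0r (le_trans ub0) // (ger0_norm (le_trans (normr_ge0 _) ub0)) lerDr ltW.
by have := HM s sb i; rewrite addr0 coef_map => /le_trans; apply; rewrite lerDl.
Qed.

Lemma poly2_bound (F : numFieldType) (Q : {poly {poly F}}) (b B : F) :
  exists2 M, 0 < M & forall s z, `|s| <= b -> `|z| <= B -> `|(at_ s Q).[z]| <= M.
Proof.
elim/poly_ind: Q => [|Q c [M M0 HM]].
  by exists 1 => // s z _ _; rewrite map_poly0 horner0 normr0.
have [ub ubP] := poly_disk_bound c b.
exists (M * (1 + `|B|) + `|ub|) => [|s z sb zB].
  by rewrite ltr_wpDr // mulr_gt0 // ltr_wpDr.
have ub0 := ubP s sb; have zB' : `|z| <= 1 + `|B|.
  by rewrite (le_trans zB) // (ger0_norm (le_trans (normr_ge0 _) zB)) lerDr.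
rewrite rmorphD rmorphM /= map_polyX map_polyC hornerD hornerM hornerX hornerC /=.
rewrite (le_trans (ler_normD _ _)) // lerD //; first by rewrite normrM ler_pM ?HM.
by rewrite (le_trans ub0) // (ger0_norm (le_trans (normr_ge0 _) ub0)).
Qed.

Lemma poly2_lipschitz (F : numFieldType) (P : {poly {poly F}}) (s0 B : F) :
  exists2 M, 0 < M & forall s z, `|s - s0| <= 1 -> `|z| <= B ->
    `|(at_ s P).[z] - (at_ s0 P).[z]| <= M * `|s - s0|.
Proof.
have atC s (q : {poly F}) : at_ s (map_poly polyC q) = q.
  by rewrite -map_poly_comp map_poly_id // => c _; rewrite /= /horner_eval hornerC.
(* The family minus its member at [s0] is divisible by ['X - s0], and the quotient is bounded. *)
have [|Q QE] := @poly_dvd_XsubC F s0 (P - map_poly polyC (at_ s0 P)).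
  by rewrite rmorphB /= atC subrr.
have [M M0 HM] := poly2_bound Q (1 + `|s0|) B.
exists M => // s z ss zB.
have s1 : `|s| <= 1 + `|s0| by rewrite -{1}(subrK s0 s) (le_trans (ler_normD _ _)) // lerD2r.
have -> : (at_ s P).[z] - (at_ s0 P).[z] = (s - s0) * (at_ s Q).[z].
  have := congr1 (fun p => (at_ s p).[z]) QE.
  rewrite -mul_polyC rmorphB rmorphM /= map_polyC hornerD hornerN hornerM hornerC /=.
  by rewrite /horner_eval hornerXsubC atC.
by rewrite normrM mulrC ler_wpM2r ?HM.
Qed.

Lemma size_at_monic (F : numFieldType) (P : {poly {poly F}}) s :
  P \is monic -> at_ s P \is monic /\ size (at_ s P) = size P.
Proof.
move=> Pm; split; first exact: monic_map.
by apply: size_map_poly_id0; rewrite (monicP Pm) rmorph1 oner_neq0.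
Qed.

(** A root z of the member at s is bounded uniformly in s, so the member at s0 is O(|s - s0|) at z
    and [monic_near_root] applies. *)
Lemma roots_upper_continuous (F : numClosedFieldType) (P : {poly {poly F}}) (s0 e : F) :
  P \is monic -> 0 < e ->
  exists2 eta, 0 < eta & forall s, `|s - s0| <= eta -> forall z, root (at_ s P) z ->
    exists2 r, root (at_ s0 P) r & `|z - r| < e.
Proof.
move=> Pm e0; have [c c0 Hc] := poly2_coef_bound P (1 + `|s0|).
have [M M0 HM] := poly2_lipschitz P s0 (1 + c *+ size P).
have d0 : 0 < 1 + M / e ^+ (size P).-1 by rewrite ltr_wpDr // divr_ge0 ?exprn_ge0 // ltW.
(* This eta is at most 1 and satisfies M eta < e^deg. *)
exists (1 + M / e ^+ (size P).-1)^-1; first by rewrite invr_gt0.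
move=> s se z sz; have [Psm Pss] := size_at_monic s Pm; have [P0m P0s] := size_at_monic s0 Pm.
have s1 : `|s - s0| <= 1.
  by rewrite (le_trans se) // invf_le1 // lerDl divr_ge0 ?exprn_ge0 // ltW.
have zB : `|z| <= 1 + c *+ size P.
  rewrite -Pss; apply: (monic_root_bound Psm sz); apply: Hc.
  by rewrite -{1}(subrK s0 s) (le_trans (ler_normD _ _)) // lerD2r.
apply: monic_near_root => //; rewrite P0s.
have := HM s z s1 zB; rewrite (eqP sz) sub0r normrN => h.
have ed0 : 0 < e ^+ (size P).-1 by rewrite exprn_gt0.
apply: (le_lt_trans h); apply: (@le_lt_trans _ _ (M * (1 + M / e ^+ (size P).-1)^-1)).
  by rewrite ler_pM2l.
by rewrite ltr_pdivrMr // mulrDr mulr1 mulrCA mulfV ?lt0r_neq0 // mulr1 ltrDr.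
Qed.

(** The same estimate with the roles of s and s0 exchanged: the member at s is small at the fixed
    root [r]. *)
Lemma roots_lower_continuous (F : numClosedFieldType) (P : {poly {poly F}}) (s0 r e : F) :
  P \is monic -> 0 < e -> root (at_ s0 P) r ->
  exists2 eta, 0 < eta & forall s, `|s - s0| <= eta ->
    exists2 z, root (at_ s P) z & `|r - z| < e.
Proof.
move=> Pm e0 r0; have [M M0 HM] := poly2_lipschitz P s0 `|r|.
have d0 : 0 < 1 + M / e ^+ (size P).-1 by rewrite ltr_wpDr // divr_ge0 ?exprn_ge0 // ltW.
exists (1 + M / e ^+ (size P).-1)^-1; first by rewrite invr_gt0.
move=> s se; have [Psm Pss] := size_at_monic s Pm.
have s1 : `|s - s0| <= 1.
  by rewrite (le_trans se) // invf_le1 // lerDl divr_ge0 ?exprn_ge0 // ltW.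
apply: monic_near_root => //; rewrite Pss.
have := HM s r s1 (lexx _); rewrite (eqP r0) subr0 => h.
have ed0 : 0 < e ^+ (size P).-1 by rewrite exprn_gt0.
apply: (le_lt_trans h); apply: (@le_lt_trans _ _ (M * (1 + M / e ^+ (size P).-1)^-1)).
  by rewrite ler_pM2l.
by rewrite ltr_pdivrMr // mulrDr mulr1 mulrCA mulfV ?lt0r_neq0 // mulr1 ltrDr.
Qed.

(** * Slices of the polydisc *)

Lemma pos_lower_bound (F : numFieldType) (T : eqType) (s : seq T) (h : T -> F) :
  (forall x, x \in s -> 0 < h x) -> exists2 m, 0 < m & forall x, x \in s -> m <= h x.
Proof.
elim: s => [|a s IH] hs; first by exists 1.
have [|m m0 mP] := IH; first by move=> x xs; apply: hs; rewrite inE xs orbT.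
have a0 : 0 < h a by apply: hs; rewrite mem_head.
have s0 : 0 < m + h a by rewrite addr_gt0.
(* Product over sum lies below both numbers, which avoids comparing them in the partially ordered
   field. *)
exists (m * h a / (m + h a)); first by rewrite divr_gt0 ?mulr_gt0.
move=> x; rewrite inE => /predU1P [->|/mP];
  first by rewrite ler_pdivrMr // mulrC ler_pM2l // lerDl ltW.
by apply: le_trans; rewrite ler_pdivrMr // ler_pM2l // lerDr ltW.
Qed.

Lemma pos_lower_bound2 (F : numFieldType) (a b : F) : 0 < a -> 0 < b ->
  exists2 m, 0 < m & m <= a /\ m <= b.
Proof.
move=> a0 b0; have [|m m0 mP] := @pos_lower_bound F F [:: a; b] id.
  by move=> x; rewrite !inE => /orP [] /eqP ->.
by exists m => //; split; apply: mP; rewrite !inE eqxx ?orbT.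
Qed.

Lemma norm_small_eq0 (F : numFieldType) (a L : F) : 0 < L ->
  (forall e, 0 < e -> `|a| <= L * e) -> a = 0.
Proof.
move=> L0 h; apply/eqP; apply: contraT => a0; have na : 0 < `|a| by rewrite normr_gt0.
have := h (`|a| / L / 2); rewrite !divr_gt0 // => /(_ isT).
have -> : L * (`|a| / L / 2) = `|a| / 2 by field; rewrite lt0r_neq0.
by rewrite -{1}(mulr1 `|a|) ler_pM2l // lt_geF // invf_lt1 // ltr1n.
Qed.

Lemma real_le_eps (F : numFieldType) (a b : F) : a \is Num.real -> b \is Num.real ->
  (forall e, 0 < e -> a <= b + e) -> a <= b.
Proof.
move=> ar br h; rewrite real_leNgt //; apply/negP => ba.
have d0 : 0 < a - b by rewrite subr_gt0.
have := h _ (divr_gt0 d0 (ltr0Sn F 1)); rewrite -lerBlDl.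
by rewrite -{1}(mulr1 (a - b)) ler_pM2l // lt_geF // invf_lt1 // ltr1n.
Qed.

(** Replaces compactness: if each element of the finite list failed for some e, a common lower bound
    of these e would contradict the hypothesis. *)
Lemma pigeonhole_small (F : numFieldType) (T : eqType) (Z : seq T) (P : F -> T -> Prop) :
  (forall e e' x, e <= e' -> P e x -> P e' x) ->
  (forall e, 0 < e -> exists2 x, x \in Z & P e x) ->
  exists2 x, x \in Z & forall e, 0 < e -> P e x.
Proof.
move=> mono; elim: Z => [|a Z IH] h; first by have [x] := h 1 ltr01.
have [ha|/existsNP [ea /not_implyP [ea0 nPa]]] := pselect (forall e, 0 < e -> P e a).
  by exists a => //; rewrite mem_head.
have [|x xZ xP] := IH; last by exists x; rewrite // inE xZ orbT.
move=> e e0; have [m m0 [me mea]] := pos_lower_bound2 e0 ea0.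
have [x] := h m m0; rewrite inE => /predU1P [-> /(mono _ _ _ mea) //|xZ Px].
by exists x => //; apply: mono Px.
Qed.

Lemma finite_product_seq (n : nat) (T : choiceType) (x0 : T) (rs : 'I_n -> seq T) :
  exists Z : seq {ffun 'I_n -> T}, forall zeta, (forall j, zeta j \in rs j) -> finfun zeta \in Z.
Proof.
pose N := \max_j size (rs j).
exists [seq [ffun j => nth x0 (rs j) (c j)] | c : {ffun 'I_n -> 'I_N.+1}] => zeta h.
apply/mapP; exists [ffun j => inord (index (zeta j) (rs j))]; first by rewrite mem_enum.
apply/ffunP => j; rewrite !ffunE inordK ?nth_index //.
rewrite ltnS; apply: leq_trans (leq_bigmax j).
by rewrite ltnW // index_mem.
Qed.

(** A linear form with coefficients 1, t, t^2, ... separates [q] from the other points of [Z] once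
    [t] avoids the roots of finitely many nonzero polynomials. *)
Lemma separating_powers (F : numFieldType) (n : nat) (Z : seq {ffun 'I_n -> F}) (q : 'I_n -> F) :
  exists t, forall zeta, zeta \in Z -> \sum_j (zeta j - q j) * t ^+ j = 0 -> zeta =1 q.
Proof.
pose v (zeta : {ffun 'I_n -> F}) : {poly F} := \sum_j (zeta j - q j) *: 'X^j.
have [t _ tP] : exists2 t, 0 < t < 1 & (\prod_(zeta <- Z | v zeta != 0) v zeta).[t] != 0.
  by apply: exists_nonroot => //; rewrite prodf_seq_neq0; apply/allP => z _; apply/implyP.
exists t => zeta zZ e; have v0 : v zeta = 0.
  apply/eqP; apply: contraT => vn0; move: tP; rewrite (big_rem zeta) //= vn0 hornerM.
  suff -> : (v zeta).[t] = 0 by rewrite mul0r eqxx.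
  by rewrite /v horner_sum -[RHS]e; apply: eq_bigr => j _; rewrite hornerZ hornerXn.
move=> j; apply/eqP; rewrite -subr_eq0; have := congr1 (fun p : {poly F} => p`_j) v0.
rewrite coef0 /v coef_sum (bigD1 j) //= big1 ?addr0 => [|i ij].
  by rewrite coefZ coefXn eqxx mulr1 => ->.
by rewrite coefZ coefXn (_ : _ == _ = false) ?mulr0 // eq_sym; apply: negbTE.
Qed.

(** A point of the variety with coordinate ring [K] is encoded as a z at which the kernel of [theta]
    vanishes. *)
Lemma integral_point (F K : comNzRingType) (n m : nat) (theta : {rmorphism {mpoly F[n]} -> K})
    (x : 'I_m -> {mpoly F[n]}) (h : {mpoly F[n]}) (g : {poly {mpoly F[m]}}) z :
  (forall f, theta f = 0 -> f.@[z] = 0) -> root (map_poly (theta \o subst x) g) (theta h) ->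
  root (map_poly (meval (fun i => (x i).@[z])) g) h.@[z].
Proof.
move=> zP gh; have /zP : theta (map_poly (subst x) g).[h] = 0.
  by rewrite -horner_map -map_poly_comp; exact/eqP.
rewrite -horner_map -map_poly_comp /root => e; rewrite -[X in _ == X]e; apply/eqP; congr _.[_].
by apply: eq_map_poly => u /=; rewrite meval_subst.
Qed.

Lemma integral_subst (F K : comNzRingType) (n m : nat) (theta : {rmorphism {mpoly F[n]} -> K})
    (x : 'I_m -> {mpoly F[n]}) :
  (forall j, integralOver (theta \o subst x) (theta 'X_j)) ->
  forall f, integralOver (theta \o subst x) (theta f).
Proof.
move=> int; apply: mpoly_ring_ind => [c|//|p q ip iq|p q ip iq].
- have -> : theta c%:MP = (theta \o subst x) c%:MP by rewrite /= mmapC.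
  exact: integral_id.
- by rewrite rmorphD; apply: integral_add.
by rewrite rmorphM; apply: integral_mul.
Qed.

Lemma at_line_subst (F : fieldType) (n : nat) (o y : 'I_n -> F) (s : F) (g : {poly {mpoly F[n]}}) :
  at_ s (map_poly (line_subst o y) g) = map_poly (meval (fun i => o i + s * y i)) g.
Proof. by rewrite -map_poly_comp; apply: eq_map_poly => u;
  rewrite /= /horner_eval horner_line_subst. Qed.

(** [Z] consists of the tuples of roots at [s0] of integral equations of the coordinates. It
    contains the fibre over [s0] but may be larger. *)
Lemma fibre_upper_continuous (F : numClosedFieldType) (K : comNzRingType) (n m : nat)
    (theta : {rmorphism {mpoly F[n]} -> K}) (x : 'I_m -> {mpoly F[n]}) (o y : 'I_m -> F) (s0 : F) :
  (forall j, integralOver (theta \o subst x) (theta 'X_j)) ->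
  exists Z : seq {ffun 'I_n -> F}, forall e, 0 < e -> exists2 eta, 0 < eta &
    forall s z, `|s - s0| <= eta -> (forall f, theta f = 0 -> f.@[z] = 0) ->
      (forall i, (x i).@[z] = o i + s * y i) ->
      exists2 zeta, zeta \in Z & forall j, `|z j - zeta j| < e.
Proof.
move=> int.
have /choice [g gP] : forall j, exists g, g \is monic /\ root (map_poly (theta \o subst x) g)
  (theta 'X_j).
  by move=> j; have [g gm gr] := int j; exists g.
pose G j := map_poly (line_subst o y) (g j).
have Gm j : G j \is monic by apply: monic_map; case: (gP j).
have /choice [rs rsP] : forall j, exists rs : seq F, forall r, root (at_ s0 (G j)) r -> r \in rs.
  move=> j; have [rs E] := closed_field_poly_normal (at_ s0 (G j)).
  exists rs => r; rewrite {}E rootZ ?root_prod_XsubC // lead_coef_eq0 monic_neq0 //.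
  exact: monic_map.
have [Z ZP] := finite_product_seq 0 rs; exists Z => e e0.
have /choice [eta etaP] : forall j, exists eta, 0 < eta /\ forall s, `|s - s0| <= eta ->
    forall z, root (at_ s (G j)) z -> exists2 r, root (at_ s0 (G j)) r & `|z - r| < e.
  by move=> j; have [eta h1 h2] := roots_upper_continuous s0 (Gm j) e0; exists eta.
have [|m' m0 mP] := @pos_lower_bound F 'I_n (enum 'I_n) eta; first by move=> j _; case: (etaP j).
exists m' => // s z sm Wz xz.
have /choice [zeta zetaP] : forall j, exists r, root (at_ s0 (G j)) r /\ `|z j - r| < e.
  move=> j; have [_ /(_ s)] := etaP j; case/(_ _ (z j)) => [||r r0 re]; last by exists r.
    by rewrite (le_trans sm) // mP ?mem_enum.
  rewrite /G at_line_subst -(mevalXU z j); have [_ gj] := gP j.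
  by rewrite -(eq_map_poly (fun u => meval_eq u xz)); apply: integral_point gj.
exists (finfun zeta); first by apply: ZP => j; apply: rsP; case: (zetaP j).
by move=> j; rewrite ffunE; case: (zetaP j).
Qed.

(* The points of the slice x_0 = x_0(p) lying over the real half-line x(p) + s e_1, s >=
   0, form a compact set inside the open polydisc; at the largest value of s the
   openness of the finite map x gives a contradiction. *)
Lemma slice_meets_boundary (R : realType) (F : numClosedFieldType) (iota : {rmorphism R -> F})
    (K : comNzRingType) (n k : nat)
    (theta : {rmorphism {mpoly F[n]} -> K}) (x : 'I_k.+2 -> {mpoly F[n]}) (p : 'I_n -> F) :
  (forall r s, (iota r <= iota s) = (r <= s)) -> (forall c, 0 <= c -> exists r, c = iota r) ->
  (forall a b : K, a * b = 0 -> a = 0 \/ b = 0) ->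
  (forall j, integralOver (theta \o subst x) (theta 'X_j)) ->
  (forall u, theta (subst x u) = 0 -> u = 0) ->
  (forall f, theta f = 0 -> f.@[p] = 0) -> (forall j, `|p j| <= 1) ->
  exists z, [/\ forall f, theta f = 0 -> f.@[z] = 0, forall j, `|z j| <= 1,
    (x ord0).@[z] = (x ord0).@[p] & ~ forall j, `|z j| < 1].
Proof.
move=> iota_le iota_surj Kdom int inj Wp p1; apply: contrapT => noz.
have inner z : (forall f, theta f = 0 -> f.@[z] = 0) -> (forall j, `|z j| <= 1) ->
    (x ord0).@[z] = (x ord0).@[p] -> forall j, `|z j| < 1.
  by move=> Wz z1 xz; apply: contrapT => nz; apply: noz; exists z.
(* The line moves the second function only, so [x ord0] stays constant along it. *)
pose i1 : 'I_k.+2 := lift ord0 ord0.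
pose o i := (x i).@[p]; pose y (i : 'I_k.+2) : F := (i == i1)%:R.
have y0 : y ord0 = 0 by [].
pose over s z := [/\ forall f, theta f = 0 -> f.@[z] = 0, forall j, `|z j| <= 1 &
  forall i, (x i).@[z] = o i + iota s * y i].
pose S : set R := [set s | 0 <= s /\ exists z, over s z].
have iota_lt0 r : 0 < iota r -> 0 < r.
  by rewrite !lt_neqAle -(rmorph0 iota) iota_le => /andP [n0 ->]; rewrite andbT;
    apply: contraNneq n0 => ->.
have supS : has_sup S.
  split; first by exists 0; split=> //; exists p; split=> // i; rewrite rmorph0 mul0r addr0.
  have [L L0 HL] := mpoly_lipschitz (x i1).
  have [r rE] := iota_surj (L + L) (addr_ge0 (ltW L0) (ltW L0)).
  exists r => s [s0 [z [Wz z1 xz]]]; rewrite -iota_le -rE.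
  have -> : iota s = (x i1).@[z] - (x i1).@[p] by rewrite xz /y eqxx mulr1 addrC addKr.
  have nn : 0 <= (x i1).@[z] - (x i1).@[p].
    by rewrite xz /y eqxx mulr1 addrC addKr -(rmorph0 iota) iota_le.
  rewrite -(ger0_norm nn) (le_trans (ler_normB _ _)) // lerD //.
    by have [] := HL z z1.
  by have [] := HL p p1.
pose sm := sup S.
have sm0 : 0 <= sm.
  by apply: (sup_upper_bound supS); split=> //; exists p; split=> // i; rewrite rmorph0 mul0r addr0.
have [Z HZ] := fibre_upper_continuous o y (iota sm) int.
(* The supremum is attained: some [zeta] in [Z] is approached by points over parameters tending to
   [sm], and polynomial conditions pass to the limit. *)
have [q [Wq q1 xq]] : exists q, over sm q.
  pose P (e : F) (zeta : {ffun 'I_n -> F}) := exists s z, [/\ `|iota s - iota sm| <= e,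
    over s z & forall j, `|z j - zeta j| <= e].
  have [||zeta _ zP] := @pigeonhole_small F _ Z P.
  - move=> e e' zeta ee' [s [z [h1 h2 h3]]]; exists s, z; split=> // [|j];
    first exact: le_trans ee'.
    exact: le_trans (h3 j) ee'.
  - move=> e e0; have [eta eta0 etaP] := HZ e e0.
    have [m m0 [me meta]] := pos_lower_bound2 e0 eta0.
    have [r rE] := iota_surj m (ltW m0).
    have r0 : 0 < r by apply: iota_lt0; rewrite -rE.
    have [s Ss sr] := sup_adherent r0 supS; have ssm := sup_upper_bound supS Ss.
    have sm_ : `|iota s - iota sm| <= m.
      rewrite distrC -rmorphB ger0_norm; last by rewrite -(rmorph0 iota) iota_le subr_ge0.
      by rewrite rE iota_le lerBlDl -lerBlDr ltW.
    have [s0 [z oz]] := Ss; have [Wz z1 xz] := oz.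
    have [zeta zZ zz] := etaP _ z (le_trans sm_ meta) Wz xz.
    exists zeta => //; exists s, z; split=> // [|j]; first exact: le_trans me.
    by rewrite ltW.
  have zeta1 j : `|zeta j| <= 1.
    apply: real_le_eps; rewrite ?normr_real ?ger0_real // => e e0.
    have [s [z [_ [_ z1 _] /(_ j) h]]] := zP e e0.
    have -> : zeta j = z j - (z j - zeta j) by ring.
    by rewrite (le_trans (ler_normB _ _)) // lerD.
  exists zeta; split=> // [f f0|i].
    have [L L0 HL] := mpoly_lipschitz f; apply: (norm_small_eq0 L0) => e e0.
    have [s [z [_ [Wz z1 _] h]]] := zP e e0.
    have [_ /(_ zeta e (ltW e0) zeta1 h)] := HL z z1.
    by rewrite (Wz f f0) sub0r normrN.
  apply/eqP; rewrite -subr_eq0; apply/eqP.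
  have [L L0 HL] := mpoly_lipschitz (x i); apply: (@norm_small_eq0 _ _ (L + 1));
    first by rewrite addr_gt0.
  move=> e e0; have [s [z [se [Wz z1 xz] h]]] := zP e e0.
  have [_ /(_ zeta e (ltW e0) zeta1 h)] := HL z z1; rewrite distrC => xe.
  have -> : (x i).@[zeta] - (o i + iota sm * y i) =
    ((x i).@[zeta] - (x i).@[z]) + (iota s - iota sm) * y i by rewrite xz; ring.
  rewrite (le_trans (ler_normD _ _)) // [leRHS]mulrDl lerD // mul1r normrM.
  apply: le_trans (se); rewrite ler_piMr //.
  by rewrite /y; case: eqP; rewrite ?normr1 ?normr0 ?ler01.
have xq0 : (x ord0).@[q] = (x ord0).@[p] by rewrite xq y0 mulr0 addr0.
have q1' := inner q Wq q1 xq0.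
have [t tP] := separating_powers Z q.
pose H : {mpoly F[n]} := \sum_(j < n) t ^+ j *: 'X_j.
have HE z : H.@[z] = \sum_(j < n) z j * t ^+ j.
  rewrite /H (raddf_sum (meval z)); apply: eq_bigr => j _; rewrite /= mevalZ mevalXU mulrC //.
pose D (zeta : 'I_n -> F) := \sum_(j < n) (zeta j - q j) * t ^+ j.
(* [kappa] is a gap between the value of the separating form at [q] and its other values on [Z]. *)
have [kappa kappa0 kappaP] : exists2 kappa, 0 < kappa &
    forall zeta, zeta \in Z -> D zeta != 0 -> kappa <= `|D zeta|.
  have [|m m0 mP] := @pos_lower_bound F _ Z (fun zeta => if D zeta == 0 then 1 else `|D zeta|).
    by move=> zeta _; case: eqP => // /eqP; rewrite normr_gt0.
  by exists m => // zeta zZ /negbTE d0; have := mP zeta zZ; rewrite d0.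
pose rho : {rmorphism {mpoly F[k.+2]} -> K} := theta \o subst x.
have [mu [mum muH mumin]] := monic_minimal_poly (rho := rho) Kdom inj (integral_subst int H).
pose muL := map_poly (line_subst o y) mu.
have muLm : muL \is monic by apply: monic_map.
have muq : root (at_ (iota sm) muL) H.@[q].
  rewrite /muL at_line_subst -(eq_map_poly (fun u => meval_eq u xq)).
  exact: integral_point muH.
have k2 : 0 < kappa / 2 by rewrite divr_gt0.
pose T := 1 + \sum_(j < n) `|t ^+ j|.
have T0 : 0 < T by rewrite ltr_wpDr // sumr_ge0.
have [|e1 e10 e1P] := @pos_lower_bound F _ (enum 'I_n) (fun j => 1 - `|q j|).
  by move=> j _; rewrite subr_gt0.
(* [e <= e1] keeps the e-neighbourhood of [q] in the closed polydisc; the other bound lets [H] vary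
   by at most kappa / 2 there. *)
have [e e0 [ee1 eT]] := pos_lower_bound2 e10 (divr_gt0 k2 T0).
have [eta eta0 etaP] := HZ e e0.
have [eta' eta'0 eta'P] := roots_lower_continuous muLm k2 muq.
have [m m0 [m1 m2]] := pos_lower_bound2 eta0 eta'0.
have [r rE] := iota_surj m (ltW m0).
have r0 : 0 < r by apply: iota_lt0; rewrite -rE.
have sr : `|iota (sm + r) - iota sm| <= m by rewrite rmorphD addrC addKr -rE ger0_norm // ltW.
have [t' t'root t'q] := eta'P _ (le_trans sr m2).
rewrite at_line_subst in t'root.
(* Openness: the root [t'] near H(q), at the larger parameter sm + r, is the value of [H] at a point
   of the variety. *)
have [p' [Wp' xp' Hp']] := lift_point int mumin t'root.
have [zeta zZ zp'] := etaP _ p' (le_trans sr m1) Wp' xp'.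
(* H(zeta) is within kappa / 2 of H(p'), and H(p') is closer than kappa / 2 to H(q). The gap forces
   H(zeta) = H(q), and the form separates. *)
have zq : zeta =1 q.
  apply: (tP _ zZ); apply/eqP; apply: contraT => /(kappaP _ zZ).
  have -> : D zeta = - (\sum_j (p' j - zeta j) * t ^+ j) - (H.@[q] - H.@[p']).
    rewrite !HE /D -sumrN -sumrB -sumrB; apply: eq_bigr => j _; ring.
  have b1 : `|\sum_j (p' j - zeta j) * t ^+ j| <= kappa / 2.
    rewrite (le_trans (ler_norm_sum _ _ _)) //; apply: (@le_trans _ _ (e * T)); last first.
      by rewrite -ler_pdivlMr.
    rewrite mulrDr mulr1 ler_wpDl ?(ltW e0) // mulr_sumr ler_sum // => j _.
    by rewrite normrM ler_wpM2r // ltW.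
  rewrite Hp'; apply: contraTT => _; rewrite lt_geF //.
  rewrite (splitr kappa) (le_lt_trans (ler_normB _ _)) // normrN.
  exact: ler_ltD.
have : S (sm + r).
  split; first by rewrite addr_ge0 // ltW.
  exists p'; split=> // j; rewrite -(subrK (q j) (p' j)) (le_trans (ler_normD _ _)) //.
  rewrite -lerBrDr (le_trans (ltW _) (le_trans ee1 (e1P j _))) ?mem_enum //.
  by have := zp' j; rewrite zq.
move/(sup_upper_bound supS); rewrite -/sm gerDl => /(lt_le_trans r0).
by rewrite ltxx.
Qed.

(** * Irreducible algebraic sets *)

Lemma prime_quotient (A : comNzRingType) (S : {pred A}) :
  idealr_closed S -> prime_idealr_closed S ->
  exists (K : comNzRingType) (theta : {rmorphism A -> K}),
    (forall a b : K, a * b = 0 -> a = 0 \/ b = 0) /\ forall f, theta f = 0 <-> f \in S.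
Proof.
move=> Sid Spr.
pose I : prime_idealr A := HB.pack (S : A -> bool) (isIdealr.Build A S Sid)
  (isPrimeIdealrClosed.Build A S Spr).
exists {ideal_quot I}, (\pi_{ideal_quot I})%qT;
  split=> [a b /Quotient.rquot_IdomainAxiom /orP [] /eqP|f].
- by left.
- by right.
split=> [/eqP|fS].
  by rewrite -(rmorph0 (\pi_{ideal_quot I})%qT) eqmodE /= Quotient.equivE subr0.
by apply/eqP; rewrite -(rmorph0 (\pi_{ideal_quot I})%qT) eqmodE /= Quotient.equivE subr0.
Qed.

(** While the constant term vanishes, the equation can be divided by its variable, since [a] cancels
    in a domain. *)
Lemma integral_constant_term (A K : comNzRingType) (rho : {rmorphism A -> K}) (a : K) :
  (forall a b : K, a * b = 0 -> a = 0 \/ b = 0) -> a <> 0 -> integralOver rho a ->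
  exists2 g : {poly A}, root (map_poly rho g) a & rho g`_0 <> 0.
Proof.
move=> Kdom a0 [g gm ga]; have [N] := ubnP (size g); elim: N g gm ga => // N IH g gm ga sg.
have [g0|] := pselect (rho g`_0 = 0); last by exists g.
have gE : g = drop_poly 1 g * 'X + (g`_0)%:P.
  rewrite -{1}(poly_take_drop 1 g) addrC; congr (_ * _ + _); rewrite ?expr1 //.
  by apply/polyP => -[|i]; rewrite coef_take_poly coefC.
case sgE : (size g) sg => [|[|d]] sg; first by move/monic_neq0: gm; rewrite -size_poly_eq0 sgE.
  move/monicP: gm; rewrite lead_coefE sgE => g1; move: g0; rewrite g1 rmorph1 => /eqP.
  by rewrite oner_eq0.
have g'm : drop_poly 1 g \is monic.
  by apply/monicP; rewrite lead_coefE size_drop_poly sgE coef_drop_poly -(monicP gm) lead_coefE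
    sgE subn1 addn1.
apply: (IH (drop_poly 1 g) g'm).
  move: ga; rewrite {1}gE rmorphD rmorphM /= map_polyX map_polyC /= g0 addr0 /root hornerM hornerX.
  by move=> /eqP /Kdom [->|].
by rewrite size_drop_poly sgE subn1.
Qed.

Section Varieties.
Context {R : realType} {n : nat}.
Implicit Types (W V : set 'rV[CC R]_n) (f g : {mpoly (CC R)[n]}) (z : 'rV[CC R]_n).

Definition vanishes W f := forall z : 'rV[CC R]_n, W z -> f.@[z 0] = 0.

Lemma algebraic_vanishing W z : algebraic_set W ->
  (forall f, vanishes W f -> f.@[z 0] = 0) -> W z.
Proof. by move=> [S ->] h p Sp; apply: h => w; apply. Qed.

Lemma algebraic_setI_zero W f : algebraic_set W -> algebraic_set (W `&` [set z : 'rV[CC R]_n |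
  f.@[z 0] = 0]).
Proof.
move=> [S ->]; exists (S `|` [set f]); apply/seteqP; split=> z /=.
  by move=> [Sz fz] p [/Sz|->].
by move=> h; split=> [p Sp|]; apply: h; [left|right].
Qed.

Lemma vanishes_mul W f g : irreducible_algebraic_set W -> vanishes W (f * g) ->
  vanishes W f \/ vanishes W g.
Proof.
move=> [Wa _ Wirr] fg.
have [||//] := Wirr _ _ (algebraic_setI_zero f Wa) (algebraic_setI_zero g Wa).
- apply/seteqP; split=> z /=; last by case=> -[].
  move=> Wz; have /eqP := fg z Wz; rewrite mevalM mulf_eq0 => /orP [] /eqP h; [left|right]; by [].
- by move=> e; left=> z; rewrite {1}e => -[].
by move=> e; right=> z; rewrite {1}e => -[].
Qed.

Lemma coordinate_ring W : irreducible_algebraic_set W ->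
  exists (K : comNzRingType) (theta : {rmorphism {mpoly (CC R)[n]} -> K}),
    (forall a b : K, a * b = 0 -> a = 0 \/ b = 0) /\ forall f, theta f = 0 <-> vanishes W f.
Proof.
move=> Wirr; have [_ [w Ww] _] := Wirr.
pose S : {pred {mpoly (CC R)[n]}} := fun f => `[< vanishes W f >].
have SP f : reflect (vanishes W f) (f \in S) by exact: asboolP.
have [||K [theta [Kdom tP]]] := @prime_quotient _ S.
- split.
  + by apply/SP => z _; rewrite meval0.
  + by apply/SP => /(_ w Ww) /eqP; rewrite meval1 oner_eq0.
  move=> a u v /SP hu /SP hv; apply/SP => z Wz.
  by rewrite mevalD mevalM hu // hv // mulr0 addr0.
- by move=> u v /SP /(vanishes_mul Wirr) [] h; apply/orP; [left|right]; apply/SP.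
by exists K, theta; split=> // f; rewrite tP; split=> /SP.
Qed.

(** [f] takes its values on [V] among the roots of [g], so [V] is a finite union of level sets, and
    irreducibility leaves only one. *)
Lemma irreducible_finite_value V f (g : {poly CC R}) : irreducible_algebraic_set V -> g != 0 ->
  (forall z, V z -> root g f.@[z 0]) -> exists r, forall z, V z -> f.@[z 0] = r.
Proof.
move=> Virr g0 gf; have [rs E] := closed_field_poly_normal g.
have : forall z, V z -> root (\prod_(r <- rs) ('X - r%:P)) f.@[z 0].
  by move=> z Vz; have := gf z Vz; rewrite {1}E rootZ // lead_coef_eq0.
have prodE s z : (\prod_(r <- s) (f - r%:MP)).@[z 0] = (\prod_(r <- s) ('X - r%:P)).[f.@[z 0]].
  rewrite horner_prod (rmorph_prod (meval (z 0))); apply: eq_bigr => r _.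
  by rewrite hornerXsubC /= mevalB mevalC.
elim: rs {E} => [|r rs IH] h.
  by have [_ [v Vv] _] := Virr; have := h v Vv; rewrite big_nil /root hornerC oner_eq0.
have [|hr|hr] := @vanishes_mul V (f - r%:MP) (\prod_(r <- rs) (f - r%:MP)) Virr.
- by move=> z Vz; apply/eqP; have := h z Vz; rewrite /root -prodE big_cons.
- by exists r => z Vz; have := hr z Vz; rewrite mevalB mevalC => /eqP; rewrite subr_eq0 => /eqP.
by apply: IH => z Vz; rewrite /root -prodE hr.
Qed.

(* If the coordinates are integral over C[x], a nonzero function vanishing on V1 makes x
   constant on V1, hence V1 is a point. *)
Lemma no_chain_over_line W V0 V1 (K : comNzRingType) (theta : {rmorphism {mpoly (CC R)[n]} -> K})
    (x : 'I_1 -> {mpoly (CC R)[n]}) :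
  (forall a b : K, a * b = 0 -> a = 0 \/ b = 0) -> (forall f, theta f = 0 <-> vanishes W f) ->
  (forall j, integralOver (theta \o subst x) (theta 'X_j)) ->
  irreducible_algebraic_set V0 -> irreducible_algebraic_set V1 -> V0 `<` V1 -> V1 `<` W -> False.
Proof.
move=> Kdom tP int V0irr V1irr V01 V1W.
have onW z : W z -> forall f, theta f = 0 -> f.@[z 0] = 0 by move=> Wz f /tP; apply.
have [V1sW nWV1] := V1W; have [V0sV1 nV10] := V01.
have [f fV1 nfW] : exists2 f, vanishes V1 f & theta f <> 0.
  have [w Ww nV1w] : exists2 w, W w & ~ V1 w by apply: contrapT => h; apply: nWV1 => w Ww;
    apply: contrapT => nV; apply: h; exists w.
  have [V1a _ _] := V1irr; apply: contrapT => h; apply: nV1w.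
  apply: algebraic_vanishing => // f fV1; apply: onW => //.
  by apply: contrapT => nf; apply: h; exists f.
(* The constant term of this relation is a polynomial in x, nonzero on [W], that vanishes wherever
   [f] does, in particular on [V1]. Hence x takes finitely many values there. *)
have [g gf g0] := integral_constant_term Kdom nfW (integral_subst int f).
pose uni : {mpoly (CC R)[1]} -> {poly CC R} := mmap polyC (fun=> 'X).
have uniE u (z : 'rV[CC R]_n) : (uni u).[(x ord0).@[z 0]] = u.@[fun i => (x i).@[z 0]].
  rewrite -[LHS]/(horner_eval _ (uni u)) mmap_rmorph; apply: mmap_ext => [c|i] /=.
    by rewrite /horner_eval hornerC.
  by rewrite /horner_eval hornerX; have -> : i = ord0 by exact: ord1.
have [r xr] : exists r, forall z, V1 z -> (x ord0).@[z 0] = r.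
  apply: (irreducible_finite_value (g := uni g`_0)) => //.
    apply/eqP => u0; apply: g0; apply/tP => z Wz.
    by rewrite meval_subst -uniE u0 horner0.
  move=> z V1z; apply/eqP; rewrite uniE.
  have := integral_point (onW z (V1sW z V1z)) gf.
  by rewrite (fV1 z V1z) /root horner_coef0 coef_map => /eqP.
(* With x constant equal to [r] on [V1], each coordinate is a root of one fixed monic polynomial,
   hence constant too. *)
have /choice [c cP] : forall j, exists c, forall z, V1 z -> z 0 j = c.
  move=> j; have [h hm hj] := int j.
  have [||c cP] := @irreducible_finite_value V1 'X_j (map_poly (meval (fun=> r)) h) V1irr.
  - by apply: monic_neq0; apply: monic_map.
  - move=> z V1z; have := integral_point (onW z (V1sW z V1z)) hj.
    rewrite (eq_map_poly (g := meval (fun=> r))) ?mevalXU // => u; apply: meval_eq => i.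
    by rewrite -(xr z V1z); have -> : i = ord0 by exact: ord1.
  by exists c => z V1z; have := cP z V1z; rewrite mevalXU.
have [_ [v V0v] _] := V0irr; apply: nV10 => z V1z.
suff -> : z = v by [].
by apply/rowP => j; rewrite !cP //; apply: V0sV1.
Qed.

Lemma closure_polydisc z : (forall j, `|z 0 j| <= 1) -> closure (polydisc R n) z.
Proof.
move=> z1 A /nbhs_ballP [e /= e0 eA].
(* Scaling by 1 - e' brings z into the open polydisc and moves each coordinate by at most e' < e. *)
have [e' e'0 [e'1 e'e]] := pos_lower_bound2 (ltr01 : 0 < 1 :> CC R) (divr_gt0 e0 (ltr0Sn (CC R) 1)).
exists ((1 - e') *: z); split=> /=.
  move=> i; rewrite mxE normrM ger0_norm ?subr_ge0 // (le_lt_trans (ler_piMr _ (z1 i)))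
    ?subr_ge0 //.
  by rewrite ltrBlDr ltrDl.
apply: eA; split=> // i j; rewrite (ord1 i) /ball /= !mxE.
have -> : z 0 j - (1 - e') * z 0 j = e' * z 0 j by ring.
rewrite normrM gtr0_norm // (le_lt_trans (ler_piMr (ltW e'0) (z1 j))) // (le_lt_trans e'e) //.
by rewrite ltr_pdivrMr // ltr_pMr // ltr1n.
Qed.

End Varieties.

(** * Chains in distinguished varieties *)

Lemma real_complex_le (R : realType) (r s : R) : (real_complex R r <= real_complex R s :> CC R)
  = (r <= s).
Proof. exact: lecR. Qed.

Lemma ge0_complex_real (R : realType) (c : CC R) : 0 <= c -> exists r, c = real_complex R r.
Proof. by case: c => a b; rewrite lecE /= => /andP [/eqP -> _]; exists a. Qed.

Lemma distinguished_no_chain (R : realType) (n : nat) (W V0 V1 : set 'rV[CC R]_n.+1) :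
  irreducible_algebraic_set W -> W `&` polydisc R n.+1 !=set0 ->
  W `&` polydisc_boundary R n.+1 = W `&` torus R n.+1 ->
  irreducible_algebraic_set V0 -> irreducible_algebraic_set V1 -> V0 `<` V1 -> V1 `<` W -> False.
Proof.
move=> Wirr [p [Wp Dp]] bd V0irr V1irr V01 V1W.
have [K [theta [Kdom tP]]] := coordinate_ring Wirr; have [Wa _ _] := Wirr.
have p1 j : `|p 0 j| <= 1 by rewrite ltW.
(* The normalization starts from the coordinates themselves; as |z_0| = 1 on the torus, z_0 keeps
   this distance from p_0 there. *)
have d0 : 0 < 1 - `|p 0 0| by rewrite subr_gt0.
pose T (z : 'I_n.+1 -> CC R) := forall j, `|z j| = 1.
have [||||k [x [int xinj [delta delta0 dP]]]] := @noether_normalization (CC R) n.+1 n K theta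
  (fun i => 'X_i) T (p 0) _ _ _ _ d0.
- move=> j; have -> : theta 'X_j = (theta \o subst (fun i : 'I_n.+1 => 'X_i)) 'X_j by rewrite /=
  mmapX mmap1U.
  exact: integral_id.
- exact: p1.
- by move=> z Tz j; rewrite Tz.
- move=> z Tz; rewrite !mevalXU -(Tz ord0); exact: lerB_dist.
(* A single function makes [W] finite over a line; with at least two, they are independent and the
   slice argument applies. *)
case: k x int xinj dP => [|k] x int xinj dP;
  first exact: (no_chain_over_line Kdom tP int V0irr V1irr).
have {}xinj u : theta (subst x u) = 0 -> u = 0 by case: xinj => // h; apply: h.
have onW z : W z -> forall f, theta f = 0 -> f.@[z 0] = 0 by move=> Wz f /tP; apply.
have [z [Wz z1 xz nz]] := slice_meets_boundary (iota := real_complex R) (@real_complex_le R)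
  (@ge0_complex_real R) Kdom int xinj (onW p Wp) p1.
pose zz : 'rV[CC R]_n.+1 := \row_j z j.
have zzE : zz 0 =1 z by move=> j; rewrite mxE.
have Wzz : W zz.
  by apply: algebraic_vanishing => // f /tP /Wz; rewrite (meval_eq _ zzE).
have : (W `&` polydisc_boundary R n.+1) zz.
  split=> //; split; first by apply: closure_polydisc => j; rewrite zzE.
  by move=> Dz; apply: nz => j; rewrite -zzE.
(* The boundary point of the slice would lie on the torus, where [x ord0] stays at distance [delta]
   from its value at [p]. *)
rewrite bd => -[_ Tz]; have := dP z (fun j => etrans (congr1 _ (esym (zzE j))) (Tz j)).
by rewrite xz subrr normr0 => /(lt_le_trans delta0); rewrite ltxx.
Qed.

Lemma variety_chain_sub (R : realType) (n : nat) (W : set 'rV[CC R]_n) (d : nat) V k :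
  variety_chain W d V -> (k <= d)%N -> V k `<=` W.
Proof.
move=> [_ Vlt VW] kd; apply: subset_trans VW; rewrite -(subnKC kd).
have : (k + (d - k) <= d)%N by rewrite subnKC.
elim: (d - k)%N => [|m IH] h; first by rewrite addn0.
rewrite addnS in h *; apply: subset_trans (IH (ltnW h)) _; exact: (Vlt _ h).1.
Qed.

Theorem theorem3p6 (R : realType) (n : nat) (hn : (2 <= n)%N)
    (Omega : set 'rV[CC R]_n) (hOmega : distinguished_variety Omega) :
  exists C : set 'rV[CC R]_n,
    [/\ algebraic_set C, has_dimension C 1 & Omega = C `&` polydisc R n].
Proof.
case: hOmega => W Wirr [Wa [d d0 [[V Vchain] _]] WD bd ->].
(* The curve is [W] itself: truncating the given chain shows dimension at least 1. *)
exists W; split=> //; split.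
  exists V; have [Virr Vlt _] := Vchain; split.
  - by move=> k k1; apply: Virr; apply: leq_trans d0.
  - by move=> k k1; apply: Vlt; apply: leq_trans d0.
  - exact: variety_chain_sub Vchain d0.
move=> e U Uchain; rewrite leqNgt; apply/negP => e2; have [Uirr Ult _] := Uchain.
case: n hn W Wirr WD bd U Uchain Uirr Ult {Omega Wa V Vchain d d0} => // n _ W Wirr WD bd U
  Uchain Uirr Ult.
(* A chain of length at least 2 gives [U 0] and [U 1], with [U 1] proper in [W] because [U 2]
   already exceeds it. *)
have U1W : U 1 `<` W.
  have [U12 nU21] := Ult 1%N e2; have U2W := variety_chain_sub Uchain e2.
  by split=> [|WU]; [exact: subset_trans U2W|apply: nU21; exact: subset_trans WU].
by apply: (distinguished_no_chain Wirr WD bd (Uirr 0%N _) (Uirr 1%N _) (Ult 0%N _) U1W);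
  rewrite // ltnW.
Qed.
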